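(* Consider the invariant line $[G,D]$ with viscosity ratio $\nu_G>8$, and let $D_2^*$ be the right $f$-extension of $D$ on $[G,D]$, such that $\sigma(D_2^*;D)=\lambda_f(D)$. Then the surface of undercompressive shocks $\mathcal{T}$ associated with the invariant plane $[G,D]\times\mathbb{R}^+$ (represented by $\mathcal{T}^-$ and $\mathcal{T}^+$, for the identity viscosity matrix) comprises the region bounded by the following curves: (1) the curves $SCB^-\subset\mathcal{T}^-$ and $SCB^+\subset\mathcal{T}^+$, connecting the points $\widehat{D}_1$ and $\widehat{\mathcal{U}}$, and $\widehat{\mathcal{U}}$ and $\widehat{D}$, respectively; (2) the curves $FCB^-\subset\mathcal{T}^-$ and $FCB^+\subset\mathcal{T}^+$, connecting the points $\widehat{D}_2^*$ and $\widehat{\mathcal{U}}$, and $\check{D}$ and $\widehat{\mathcal{U}}$, respectively; (3) the curves $GUB^-\subset\mathcal{T}^-$ and $GUB^+\subset\mathcal{T}^+$, connecting the points $\widehat{D}_2^*$ and $\widehat{D}_1$, and $\check{D}$ and $\widehat{D}$, respectively.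
   Context: Model. Let $\mu_w,\mu_o,\mu_g>0$. States are $U=(s_w,s_o)\in\Omega=\{s_w,s_o\ge0,\ s_w+s_o\le1\}$, $s_g=1-s_w-s_o$. The flux is $F=(f_w,f_o)$, $f_i=(s_i^2/\mu_i)/(\sum_{j\in\{w,o,g\}}s_j^2/\mu_j)$; $\lambda_s\le\lambda_f$ are the eigenvalues of $DF$. The umbilic point is $\mathcal{U}$ with $(s_w,s_o,s_g)=(\mu_w,\mu_o,\mu_g)/(\mu_w+\mu_o+\mu_g)$. Invariant line. $G$ is the vertex $s_g=1$; $\nu_G=(\mu_w+\mu_o)/\mu_g$; $[G,D]$ is the set of states with $s_w/\mu_w=s_o/\mu_o$, parametrized by $s=s_w+s_o\in[0,1]$ ($s=0$ at $G$, $s=1$ at $D$, on the edge $s_g=0$); $s_M$ is the parameter of a state $M$. One has $s_{\mathcal{U}}=\nu_G/(1+\nu_G)$. With $E(s)=s^2+\nu_G(1-s)^2$, the eigenvalues along the line are $\lambda_a=2s/E$ and $\lambda_b=2\nu_Gs(1-s)/E^2$, $\lambda_s=\min$, $\lambda_f=\max$; the Rankine-Hugoniot speed between states of the line is $\sigma(M;N)=\nu_G(s_M+s_N-2s_Ms_N)/(E(s_M)E(s_N))$. Shocks (viscosity matrix equal to identity). A shock from $U^-$ (left) to $U^+$ (right) with speed $\sigma$ satisfies $F(U^+)-F(U^-)=\sigma(U^+-U^-)$ and has an orbit of $\dot U=F(U)-F(U^-)-\sigma(U-U^-)$ from $U^-$ to $U^+$. It is: undercompressive (a $u$-shock) if $\lambda_s(U^\pm)<\sigma<\lambda_f(U^\pm)$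 (saddle to saddle); a left-characteristic $s$-shock if $\lambda_s(U^+)<\sigma=\lambda_s(U^-)$ and $\sigma<\lambda_f(U^+)$; a right-characteristic $f$-shock if $\lambda_f(U^+)=\sigma<\lambda_f(U^-)$ and $\lambda_s(U^-)<\sigma$. Special states on $[G,D]$. $D_1$: $\lambda_s(D_1)=\sigma(D_1;D)$ with $s_{D_1}=\nu_G/(2+\nu_G)$. $D_2^*\in[G,\mathcal{U}]$: $\sigma(D_2^*;D)=\lambda_f(D)$ with $s_{D_2^*}=\frac{3\nu_G+\sqrt{\nu_G(\nu_G-8)}}{4(\nu_G+1)}$. Undercompressive interval. For $M\in(\mathcal{U},D]$, $\mathfrak{S}(M)\in[G,\mathcal{U})$ is the state with $\sigma(\mathfrak{S};M)=\lambda_s(\mathfrak{S})$, and $\mathcal{F}(M)\in[G,\mathcal{U})$ is the state with $\sigma(\mathcal{F};M)=\lambda_f(M)$ (the one with largest $s_{\mathcal{F}}$). States $U$ strictly between $\mathcal{F}(M)$ and $\mathfrak{S}(M)$ are joined to $M$ by an undercompressive shock. Write $\sigma_{\mathfrak{S}}=\sigma(\mathfrak{S}(M);M)$, $\sigma_{\mathcal{F}}=\sigma(\mathcal{F}(M);M)$. Surface. In $\Omega\times\mathbb{R}^+$ (state, speed) put $\mathcal{C}_M^-=\{(U,\sigma(U;M)):U\in[\mathcal{F}(M),\mathfrak{S}(M)]\}$ and $\mathcal{C}_M^+=\{(M,v):\sigma_{\mathfrak{S}}\le v\le\sigma_{\mathcal{F}}\}$. The undercompressive surface $\mathcal{T}$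 is represented in $(U^-,\sigma)$-coordinates by $\mathcal{T}^-=\bigcup_{M\in(\mathcal{U},D]}\mathcal{C}_M^-$ and in $(U^+,\sigma)$-coordinates by $\mathcal{T}^+=\bigcup_{M\in(\mathcal{U},D]}\mathcal{C}_M^+$; both lie in the plane $[G,D]\times\mathbb{R}^+$. Boundary curves (with $M\in(\mathcal{U},D]$; the superscript $-$ collects the left-state points, $+$ the right-state points; end points are included as limits). $SCB$ (slow characteristic boundary): $SCB^-=\{(\mathfrak{S},\sigma(\mathfrak{S};M))\}$, $SCB^+=\{(M,\sigma(\mathfrak{S};M))\}$ over pairs $\mathfrak{S}\in[G,\mathcal{U})$, $M$ joined by a left-characteristic $s$-shock. $FCB$ (fast characteristic boundary): $FCB^-=\{(\mathcal{F},\sigma(\mathcal{F};M))\}$, $FCB^+=\{(M,\sigma(\mathcal{F};M))\}$ over pairs $\mathcal{F}=\mathcal{F}(M)\in[G,\mathcal{U})$, $M$ joined by a right-characteristic $f$-shock ($\sigma=\lambda_f(M)$). $GUB$ (genuine undercompressive boundary): $GUB^-=\{(U,\sigma(U;D))\}$, $GUB^+=\{(D,\sigma(U;D))\}$ over $U\in(\mathcal{F}(D),\mathfrak{S}(D))$. Lifted points. $\widehat{\mathcal{U}}=(\mathcal{U},2)$ where $2=\lambda_s(\mathcal{U})=\lambda_f(\mathcal{U})$; $\widehat{D}_1=(D_1,\sigma(D_1;D))$; $\widehat{D}=(D,\sigma(D_1;D))$; $\widehat{D}_2^*=(D_2^*,\sigma(D_2^*;D))$; $\check{D}=(D,\sigma(D_2^*;D))$.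 *)

(* Defs.v *)
From HB Require Import structures.
From mathcomp Require Import all_boot all_order all_algebra.
From mathcomp Require Import all_classical all_reals all_analysis.
Set Implicit Arguments.
Unset Strict Implicit.
Unset Printing Implicit Defensive.
Import Order.TTheory GRing.Theory Num.Theory.
Import numFieldNormedType.Exports.
Local Open Scope classical_set_scope.
Local Open Scope ring_scope.

Section PlaneCurves.
Variable R : realType.

Definition simple_arc (X : topologicalType) (C : set X) (p q : X) : Prop :=
  exists g : R -> X,
    [/\ {within `[0, 1], continuous g}, {in `[0, 1] &, injective g},
        g 0 = p, g 1 = q & C = g @` `[0, 1]].

Definition simple_closed_curve (C : set (R * R)) : Prop :=
  exists g : R -> R * R,
    [/\ {within `[0, 1], continuous g}, {in `[0, 1[ &, injective g},
        g 0 = g 1 & C = g @` `[0, 1]].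

(* K is the Jordan curve C together with its inside, i.e. the points whose
   connected component in the complement of C is bounded. *)
Definition region_bounded_by (C K : set (R * R)) : Prop :=
  simple_closed_curve C /\
  K = C `|` [set p | ~ C p /\ bounded_set (connected_component (~` C) p)].

End PlaneCurves.

Section Model.
Variables (R : realType) (mw mo mg : R).

(* A state is the pair (s_w, s_o). *)
Local Notation state := (R * R)%type.
Implicit Types (U V M : state) (v : R).

Definition s_g U : R := 1 - U.1 - U.2.

Definition Omega : set state :=
  [set U | [/\ 0 <= U.1, 0 <= U.2 & U.1 + U.2 <= 1]].

Definition total_mobility U : R :=
  U.1 ^+ 2 / mw + U.2 ^+ 2 / mo + s_g U ^+ 2 / mg.
Definition f_w U : R := U.1 ^+ 2 / mw / total_mobility U.
Definition f_o U : R := U.2 ^+ 2 / mo / total_mobility U.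

Definition DF U : 'M[R]_2 :=
  \matrix_(i < 2, j < 2)
    let f := if i == ord0 then f_w else f_o in
    if j == ord0 then derive1 (fun x => f (x, U.2)) U.1
    else derive1 (fun y => f (U.1, y)) U.2.

Definition lambda_s U : R := inf [set a | eigenvalue (DF U) a].
Definition lambda_f U : R := sup [set a | eigenvalue (DF U) a].

Definition rankine_hugoniot U V v : Prop :=
  f_w V - f_w U = v * (V.1 - U.1) /\ f_o V - f_o U = v * (V.2 - U.2).

(* sigma(U; V); the Rankine-Hugoniot condition determines it only if U <> V. *)
Definition sigma U V : R := xget 0 [set v | rankine_hugoniot U V v].

(* The viscosity matrix is the identity. *)
Definition travelling_wave U V v : Prop :=
  exists phi : R -> state,
    [/\ forall t, Omega (phi t) /\
          is_derive t 1 (fun t => (phi t).1)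
            (f_w (phi t) - f_w U - v * ((phi t).1 - U.1)) /\
          is_derive t 1 (fun t => (phi t).2)
            (f_o (phi t) - f_o U - v * ((phi t).2 - U.2)),
        phi t @[t --> -oo] --> U & phi t @[t --> +oo] --> V].

Definition shock U V v : Prop :=
  [/\ Omega U, Omega V, rankine_hugoniot U V v & travelling_wave U V v].

Definition left_char_s_shock U V v : Prop :=
  [/\ shock U V v, lambda_s V < v, v = lambda_s U & v < lambda_f V].

Definition right_char_f_shock U V v : Prop :=
  [/\ shock U V v, lambda_f V = v, v < lambda_f U & lambda_s U < v].

Definition nu_G : R := (mw + mo) / mg.

Definition vG : state := (0, 0).
Definition vD : state := (mw / (mw + mo), mo / (mw + mo)).
Definition umbilic : state :=
  (mw / (mw + mo + mg), mo / (mw + mo + mg)).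

Definition line_GD : set state :=
  [set U | Omega U /\ U.1 / mw = U.2 / mo].

(* The parameter s = s_w + s_o, injective on [G, D]. *)
Definition par U : R := U.1 + U.2.

Definition seg_GU_open : set state :=
  [set U | line_GD U /\ par U < par umbilic].
Definition seg_UD : set state :=
  [set M | line_GD M /\ par umbilic < par M].

Definition frakS M : state :=
  xget vG [set S | seg_GU_open S /\ sigma S M = lambda_s S].

Definition frakF M : state :=
  xget vG [set F | [/\ seg_GU_open F, sigma F M = lambda_f M &
    forall F', seg_GU_open F' -> sigma F' M = lambda_f M -> par F' <= par F]].

Definition plane_GD : set (state * R) := [set p | line_GD p.1 /\ 0 < p.2].

(* The coordinates (s, speed) of the plane [G, D] x R^+. *)
Definition coords (p : state * R) : R * R := (par p.1, p.2).

Definition T_minus : set (state * R) :=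
  \bigcup_(M in seg_UD)
    [set (U, sigma U M) | U in [set U | line_GD U /\
                                 par (frakF M) <= par U <= par (frakS M)]].

Definition T_plus : set (state * R) :=
  \bigcup_(M in seg_UD)
    [set (M, v) | v in `[sigma (frakS M) M, sigma (frakF M) M]].

Definition SCB_pair S M : Prop :=
  [/\ seg_GU_open S, seg_UD M & left_char_s_shock S M (sigma S M)].
Definition SCB_minus : set (state * R) :=
  [set p | exists S M, SCB_pair S M /\ p = (S, sigma S M)].
Definition SCB_plus : set (state * R) :=
  [set p | exists S M, SCB_pair S M /\ p = (M, sigma S M)].

Definition FCB_pair F M : Prop :=
  [/\ F = frakF M, seg_GU_open F, seg_UD M &
      right_char_f_shock F M (sigma F M)].
Definition FCB_minus : set (state * R) :=
  [set p | exists F M, FCB_pair F M /\ p = (F, sigma F M)].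
Definition FCB_plus : set (state * R) :=
  [set p | exists F M, FCB_pair F M /\ p = (M, sigma F M)].

Definition GUB_range : set state :=
  [set U | line_GD U /\ par (frakF vD) < par U < par (frakS vD)].
Definition GUB_minus : set (state * R) :=
  [set (U, sigma U vD) | U in GUB_range].
Definition GUB_plus : set (state * R) :=
  [set (vD, sigma U vD) | U in GUB_range].

End Model.

Arguments coords {R} p.

(* Main.v *)
Require Import Defs.
From HB Require Import structures.
From mathcomp Require Import all_boot all_order all_algebra.
From mathcomp Require Import all_classical all_reals all_analysis.
From mathcomp Require Import ring lra.
Set Implicit Arguments.
Unset Strict Implicit.
Unset Printing Implicit Defensive.
Import Order.TTheory GRing.Theory Num.Theory.
Import numFieldNormedType.Exports.
Local Open Scope classical_set_scope.
Local Open Scope ring_scope.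

(** Along the invariant line everything is explicit in the parameter s: the
    model becomes a scalar law with flux s^2 / den s, and the eigenvalues of DF
    are the derivative speed_b of this flux and a transverse one, speed_a. They
    cross at the umbilic point, and speed_a is below 2 on its left and at least
    2 on its right. Two factorizations carry the proof.

    The first, chord_speed_a, says that chord u m - speed_a u has the sign of
    ext m - u. Hence the state S(M) is given by ext, and the state F(M), for
    which the roles of the two ends are exchanged, by the inverse of ext. For
    nu > 8 the map ext is a decreasing bijection between the relevant intervals
    (ext_sub), it fixes the umbilic point, and a state u lies
    in the undercompressive interval [F(m), S(m)] of a right state m exactly
    when ext u <= m and u <= ext m.

    The second, chord_sub, expresses the difference of two chord slopes by the
    symmetric polynomial concavity, which increases in each argument and is
    positive on the states that matter (concavity_gt0, where the factorization
    concavity_ext is decisive). This gives at once the strict inequalities in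
    the definition of the shocks, the monotonicity of the chord speed in each of
    its ends, and a sign for the field of the travelling wave between the two
    states. The orbit is then obtained by separation of variables, the time
    being a linear combination of three logarithms (line_orbit).

    In the coordinates (s, speed) the set of right states is the region between
    the graphs of speed_a o ext and speed_a over [s_umb, 1]. The set of left
    states is the region over [ext_inv 1, s_umb] between the maximum of
    chord u 1 and speed_a u and the graph of speed_a o ext, by the intermediate
    value theorem in the right state. The boundary curves are pieces of these
    graphs and, for right states, the vertical segment over s = 1; that they
    enclose precisely the region is the elementary lemma region_between. *)

(** * Arcs in topological spaces *)

Section RealContinuity.
Variables (R : realType) (f g : R -> R).
Hypotheses (cf : continuous f) (cg : continuous g).

Lemma continuous_add : continuous (fun x => f x + g x).
Proof. by move=> x; apply: cvgD; [exact: cf|exact: cg]. Qed.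

Lemma continuous_opp : continuous (fun x => - f x).
Proof. by move=> x; apply: cvgN; exact: cf. Qed.

Lemma continuous_mul : continuous (fun x => f x * g x).
Proof. by move=> x; apply: cvgM; [exact: cf|exact: cg]. Qed.

Lemma continuous_sqr : continuous (fun x => f x ^+ 2).
Proof. by move=> x; apply: cvgM; exact: cf. Qed.

Lemma continuous_quot : (forall x, g x != 0) -> continuous (fun x => f x / g x).
Proof. by move=> g0 x; apply: cvgM; [exact: cf|apply: cvgV; [|exact: cg]]. Qed.

End RealContinuity.

(* Dispatching on the head symbol keeps the lemmas above from being tried up to
   conversion, where unfolding the ring operations is very slow. *)
Ltac poly_continuous := lazymatch goal with
  | |- continuous (fun x => @GRing.add _ (@?f x) (@?g x)) =>
      apply: (@continuous_add _ f g); poly_continuous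
  | |- continuous (fun x => @GRing.mul _ (@?f x) (@?g x)) =>
      apply: (@continuous_mul _ f g); poly_continuous
  | |- continuous (fun x => @GRing.opp _ (@?f x)) =>
      apply: (@continuous_opp _ f); poly_continuous
  | |- continuous (fun x => @GRing.exp _ (@?f x) 2) =>
      apply: (@continuous_sqr _ f); poly_continuous
  | |- continuous (fun x => x) => by move=> ?; exact: cvg_id
  | _ => by move=> ?; exact: cvg_cst
  end.

Lemma continuous_pair (S X Y : topologicalType) (f : S -> X) (g : S -> Y) :
  continuous f -> continuous g -> continuous (fun t => (f t, g t)).
Proof. by move=> cf cg t; exact: (cvg_pair (cf t) (cg t)). Qed.

Section Arcs.
Variable R : realType.

Lemma within_comp (X : topologicalType) (A B : set R) (f : R -> R)
    (g : R -> X) : continuous f -> (forall x, A x -> B (f x)) ->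
  {within B, continuous g} -> {within A, continuous (g \o f)}.
Proof.
move=> cf fAB /subspace_continuousP cg; apply/subspace_continuousP => x Ax.
apply: cvg_trans (cg _ (fAB _ Ax)).
move=> P BP.
have := cf x _ BP; rewrite !nbhs_simpl /within /= => H.
by apply: filterS H => y Py Ay; apply: Py; apply: fAB.
Qed.

Lemma simple_arc_image (X : topologicalType) (g : R -> X) (a b : R) :
  a < b -> {within `[a, b], continuous g} -> {in `[a, b] &, injective g} ->
  simple_arc R (g @` `[a, b]) (g a) (g b).
Proof.
move=> ab cg ig; have ba : 0 < b - a by lra.
pose f t := a + t * (b - a).
have fin t : t \in `[0, 1] -> f t \in `[a, b].
  rewrite !in_itv /= /f => /andP[t0 t1]; apply/andP; split; nra.
exists (g \o f); split.
- apply: within_comp cg => [|x]; [rewrite /f; poly_continuous|by move=> /fin].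
- move=> x y /fin fx /fin fy /(ig _ _ fx fy) /addrI /mulIf; apply; lra.
- by rewrite /= /f mul0r addr0.
- by rewrite /= /f mul1r addrC subrK.
- apply/seteqP; split=> _ [x /= xab <-].
  + exists ((x - a) / (b - a)) => /=; last first.
      by rewrite /f divfK ?gt_eqF// addrC subrK.
    move: xab; rewrite !in_itv /= => /andP[xa xb].
    by rewrite ler_pdivlMr // ler_pdivrMr // mul0r mul1r; lra.
  + by exists (f x) => //; exact: fin.
Qed.

Lemma simple_arc_sym (X : topologicalType) (C : set X) (p q : X) :
  simple_arc R C p q -> simple_arc R C q p.
Proof.
move=> [g [cg ig g0 g1 ->]].
have fin (t : R) : t \in `[0, 1] -> 1 - t \in `[0, 1] by rewrite !in_itv /=; lra.
exists (g \o (fun t => 1 - t)); split.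
- apply: within_comp cg => [|x]; [poly_continuous|by move=> /fin].
- by move=> x y /fin fx /fin fy /(ig _ _ fx fy); lra.
- by rewrite /= subr0.
- by rewrite /= subrr.
- apply/seteqP; split=> _ [x /= xab <-]; exists (1 - x) => /=; rewrite ?fin//.
  by congr g; lra.
Qed.

(** A compact arc is closed, so taking the closure of a curve adds no more than
    the end points; this is how the limit points of the boundary curves enter. *)
Lemma closure_arc (X : topologicalType) (g : R -> X) (a b : R) (C : set X) :
  hausdorff_space X -> a < b -> continuous g ->
  g @` `]a, b[ `<=` C -> C `<=` g @` `[a, b] -> closure C = g @` `[a, b].
Proof.
move=> hX ab cg gC Cg; apply/seteqP; split.
  have cl : closed (g @` `[a, b]).
    apply: compact_closed => //; apply: continuous_compact.
      exact: continuous_subspaceT.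
    exact: segment_compact.
  by apply: subset_trans (closureS Cg) _; rewrite -((closure_id _).1 cl).
move=> _ [x /= xab <-] V /cg /= [e /= e0 eV].
pose y := Num.max a (x - e / 2); pose z := Num.min b (x + e / 2).
move: xab; rewrite in_itv /= => /andP[ax xb].
have yz : y < z by rewrite /y /z gt_max !lt_min; lra.
pose w := (y + z) / 2.
have yw : y < w by rewrite /w; lra.
have wz : w < z by rewrite /w; lra.
move: yw wz; rewrite {1}/y {1}/z gt_max lt_min => /andP[aw xw] /andP[wb wx].
exists (g w); split.
  by apply: gC; exists w => //=; rewrite in_itv /=; lra.
by apply: eV => /=; rewrite ltr_norml; lra.
Qed.

Definition glue (X : Type) (g h : R -> X) (t : R) : X :=
  if t <= 2^-1 then g (2 * t) else h (2 * t - 1).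

Lemma glue_continuous (X : topologicalType) (g h : R -> X) :
  {within `[0, 1], continuous g} -> {within `[0, 1], continuous h} ->
  g 1 = h 0 -> {within `[0, 1], continuous (glue g h)}.
Proof.
move=> cg ch gh.
have -> : `[(0:R), 1]%classic = `[0, 2^-1] `|` `[2^-1, 1].
  apply/seteqP; split=> x /=; rewrite !in_itv /=; last by case; lra.
  by move=> x01; case: (leP x 2^-1) => ?; [left|right]; lra.
apply: withinU_continuous; [exact: itv_closed|exact: itv_closed| |].
- apply: (@subspace_eq_continuous _ _ _ (g \o (fun t => 2 * t))).
    by move=> x; rewrite inE /= in_itv /glue /= => /andP[_ ?]; rewrite /from_subspace ifT.
  apply: within_comp cg => [|x /=]; [poly_continuous|by rewrite !in_itv /=; lra].
- apply: (@subspace_eq_continuous _ _ _ (h \o (fun t => 2 * t - 1))).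
    move=> x; rewrite inE /= in_itv /from_subspace /glue /= => /andP[x2 _].
    case: leP => // x2'; have -> : x = 2^-1 by lra.
    by rewrite divff // gh; congr h; lra.
  apply: within_comp ch => [|x /=]; [poly_continuous|by rewrite !in_itv /=; lra].
Qed.

Lemma glue_image (X : Type) (g h : R -> X) : g 1 = h 0 ->
  glue g h @` `[0, 1] = g @` `[0, 1] `|` h @` `[0, 1].
Proof.
move=> gh; apply/seteqP; split=> [_ [x /= + <-]|_ [] [x /= + <-]];
    rewrite in_itv /= => /andP[x0 x1].
- rewrite /glue; case: leP => x2; [left|right].
    by exists (2 * x) => //=; rewrite in_itv /=; lra.
  by exists (2 * x - 1) => //=; rewrite in_itv /=; lra.
- exists (x / 2); first by rewrite /= in_itv /=; lra.
  by rewrite /glue ifT; [congr g|]; lra.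
- exists ((x + 1) / 2); first by rewrite /= in_itv /=; lra.
  rewrite /glue; case: leP => x2; last by congr h; lra.
  have -> : x = 0 by lra.
  by rewrite -gh; congr g; lra.
Qed.

Lemma simple_arc_cat (X : topologicalType) (A B : set X) (p q r : X) :
  simple_arc R A p q -> simple_arc R B q r -> A `&` B `<=` [set q] ->
  simple_arc R (A `|` B) p r.
Proof.
move=> [g [cg ig g0 g1 ->]] [h [ch ih h0 h1 ->]] AB.
have gh : g 1 = h 0 by rewrite g1 h0.
have key x y : g x = h y -> x \in `[0, 1] -> y \in `[0, 1] -> y = 0.
  move=> xy x01 y01; apply: ih; rewrite ?in_itv /= ?lexx ?ler01 //.
  rewrite h0; apply: AB; split; last by exists y.
  by exists x.
exists (glue g h); split => //.
- exact: glue_continuous.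
- move=> x y; rewrite !in_itv /= => x01 y01; rewrite /glue.
  case: leP => x2; case: leP => y2.
  + move/ig; rewrite !in_itv /= => H; have : 2 * x = 2 * y by apply: H; lra.
    lra.
  + move/key; rewrite !in_itv /= => H;
    have : 2 * y - 1 = 0 by apply: H; lra.
    lra.
  + move/esym/key; rewrite !in_itv /= => H.
    have : 2 * x - 1 = 0 by apply: H; lra.
    lra.
  + move/ih; rewrite !in_itv /= => H;
      have : 2 * x - 1 = 2 * y - 1 by apply: H; lra.
    lra.
- by rewrite /glue mulr0 g0 ifT// invr_ge0 ler0n.
- by rewrite /glue ifF; [rewrite -h1; congr h; lra|lra].
- by rewrite glue_image.
Qed.

Lemma simple_closed_cat (A B : set (R * R)) (p q : R * R) :
  simple_arc R A p q -> simple_arc R B q p -> A `&` B `<=` [set p; q] ->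
  simple_closed_curve (A `|` B).
Proof.
move=> [g [cg ig g0 g1 ->]] [h [ch ih h0 h1 ->]] AB.
have gh : g 1 = h 0 by rewrite g1 h0.
have key x y : g x = h y -> x \in `[0, 1] -> y \in `[0, 1] ->
    y = 0 \/ y = 1.
  move=> xy x01 y01.
  have [] : [set p; q] (h y).
  + by apply: AB; split; [exists x|exists y].
  + by move=> hy; right; apply: ih; rewrite ?in_itv /= ?lexx ?ler01 // h1.
  + by move=> hy; left; apply: ih; rewrite ?in_itv /= ?lexx ?ler01 // h0.
exists (glue g h); split.
- exact: glue_continuous.
- move=> x y; rewrite !in_itv /= => x01 y01; rewrite /glue.
  case: leP => x2; case: leP => y2.
  + move/ig; rewrite !in_itv /= => H; have : 2 * x = 2 * y by apply: H; lra.
    lra.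
  + move/key; rewrite !in_itv /= => H.
    have [] : 2 * y - 1 = 0 \/ 2 * y - 1 = 1 by apply: H; lra.
      lra.
    lra.
  + move/esym/key; rewrite !in_itv /= => H.
    have [] : 2 * x - 1 = 0 \/ 2 * x - 1 = 1 by apply: H; lra.
      lra.
    lra.
  + move/ih; rewrite !in_itv /= => H;
      have : 2 * x - 1 = 2 * y - 1 by apply: H; lra.
    lra.
- rewrite /glue mulr0 ifT ?invr_ge0 ?ler0n// g0 ifF; last by lra.
  by rewrite -h1; congr h; lra.
- by rewrite glue_image.
Qed.

End Arcs.

(** * The region between two graphs *)

Section RegionBetweenGraphs.
Variables (R : realType) (a b : R) (lo up : R -> R).
Hypotheses (ab : a < b) (clo : continuous lo) (cup : continuous up).
Hypotheses (lo_up_a : lo a = up a) (lo_up : forall x, a < x < b -> lo x < up x)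
  (lo_up_b : lo b <= up b).

Definition graph (f : R -> R) (c d : R) : set (R * R) :=
  (fun x => (x, f x)) @` `[c, d].

Definition vertical_side (x c d : R) : set (R * R) :=
  (fun y => (x, y)) @` `[c, d].

Definition between : set (R * R) :=
  [set p | a <= p.1 <= b /\ lo p.1 <= p.2 <= up p.1].

(* The left ends of the two graphs coincide; on the right they are joined by a
   vertical segment, which is a single point when lo b = up b. *)
Let rim := graph lo a b `|` graph up a b `|` vertical_side b (lo b) (up b).
Let core : set (R * R) := [set p | a < p.1 < b /\ lo p.1 < p.2 < up p.1].

Let le_lo_up x : a <= x <= b -> lo x <= up x.
Proof.
rewrite le_eqVlt => /andP[/orP[/eqP <- _|ax]]; first by rewrite lo_up_a.
rewrite le_eqVlt => /orP[/eqP -> //|xb].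
by apply/ltW/lo_up; rewrite ax.
Qed.

Let rim_between : rim `<=` between.
Proof.
move=> p [[]|] [x /=]; rewrite in_itv /= => + <-; rewrite /between /=.
- by move=> xab; split=> //; rewrite lexx le_lo_up.
- by move=> xab; split=> //; rewrite lexx le_lo_up.
- by rewrite lexx (ltW ab).
Qed.

Let betweenE : between = rim `|` core.
Proof.
apply/seteqP; split=> [[x y] [/= /andP[ax xb] /andP[ly yu]]|p [/rim_between //|]].
  have [yl|ly'] := eqVneq y (lo x).
    by left; left; left; exists x; rewrite /= ?yl// in_itv /= ax.
  have [yE|yu'] := eqVneq y (up x).
    by left; left; right; exists x; rewrite /= ?yE// in_itv /= ax.
  have [xE|xb'] := eqVneq x b.
    by left; right; exists y; rewrite /= -?xE// in_itv /= ly.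
  have ax' : a != x.
    by apply: contra ly' => /eqP ax'; rewrite eq_le ly -ax' lo_up_a ax' yu.
  rewrite eq_sym in ly'.
  by right; split; rewrite /= !lt_neqAle ?ax ?xb ?ly ?yu ?ax' ?xb' ?yu' ?ly'.
by case=> /andP[ax xb] /andP[ly yu]; split; rewrite !ltW.
Qed.

Let rim_core p : core p -> ~ rim p.
Proof.
move=> [/andP[p1 p2] /andP[p3 p4]] [[]|] [x _ pE]; move: p1 p2 p3 p4;
  by rewrite -pE /= ltxx.
Qed.

Let cont_fst : continuous (fun p : R * R => p.1).
Proof. by move=> p; exact: cvg_fst. Qed.
Let cont_snd : continuous (fun p : R * R => p.2).
Proof. by move=> p; exact: cvg_snd. Qed.
Let cont_fst_comp (f : R -> R) : continuous f -> continuous (fun p : R * R => f p.1 : R).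
Proof. by move=> cf p; apply: continuous_comp; [exact: cvg_fst|exact: cf]. Qed.

Let open_lt_fun (f g : R * R -> R) : continuous f -> continuous g ->
  open [set p | f p < g p].
Proof.
move=> cf cg; rewrite (_ : [set _ | _] = (fun p => g p - f p) @^-1` [set x | 0 < x]).
  by apply: open_comp => // p _; apply: cvgB; [exact: cg|exact: cf].
by apply/seteqP; split=> p /=; rewrite subr_gt0.
Qed.

Let open_core : open core.
Proof.
rewrite (_ : core = ([set p | a < p.1] `&` [set p | p.1 < b]) `&`
  ([set p | lo p.1 < p.2] `&` [set p | p.2 < up p.1])).
  apply: openI; apply: openI; apply: open_lt_fun => //;
    by [exact: cst_continuous | exact: cont_fst_comp].
apply/seteqP; split=> p; first by move=> [/andP[? ?] /andP[? ?]].
by move=> [[/= ? ?] [/= ? ?]]; split; apply/andP.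
Qed.

Let closed_between : closed between.
Proof.
rewrite (_ : between = ~` ([set p | p.1 < a] `|` [set p | b < p.1] `|`
  ([set p | p.2 < lo p.1] `|` [set p | up p.1 < p.2]))).
  apply: open_closedC; apply: openU; apply: openU; apply: open_lt_fun => //;
    by [exact: cst_continuous | exact: cont_fst_comp].
apply/seteqP; split=> p.
  by move=> [/andP[p1 p2] /andP[p3 p4]] [[]|[]] /=; rewrite ltNge ?p1 ?p2 ?p3 ?p4.
by rewrite /between /= !not_orP => -[[/negP + /negP +] [/negP + /negP +]];
  rewrite -!leNgt => -> -> -> ->.
Qed.

Let bounded_core : bounded_set core.
Proof.
have bounded_on (f : R -> R) : continuous f -> exists M, forall x, `[a, b]%classic x ->
    `|f x| <= M.
  move=> cf; have [|M [_ HM]] := @compact_bounded R R^o (f @` `[a, b]).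
    by apply: continuous_compact (@segment_compact _ _ _); exact: continuous_subspaceT.
  by exists (M + 1) => x xab; apply: (HM _ _ (f x)); [lra|exists x].
have [M1 lo1] := bounded_on _ clo; have [M2 up2] := bounded_on _ cup.
exists (Num.max (Num.max `|a| `|b|) (Num.max M1 M2)); split; first exact: num_real.
move=> e + [x y] [/= /andP[ax xb] /andP[ly yu]].
rewrite !gt_max => /andP[/andP[ae be] /andP[M1e M2e]].
have xab : `[a, b]%classic x by rewrite /= in_itv /= !ltW.
have l1 := le_trans (lo1 _ xab) (ltW M1e).
have u1 := le_trans (up2 _ xab) (ltW M2e).
rewrite prod_normE /= ge_max.
move: ae be l1 u1; rewrite !ltr_norml !ler_norml.
by move=> /andP[? ?] /andP[? ?] /andP[? ?] /andP[? ?]; apply/andP; split; lra.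
Qed.

(* The core and the complement of the closed region are separated, and together
   they make up the complement of the rim: a connected set that meets the core
   and avoids the rim cannot leave the core. *)
Let component_core p : core p -> connected_component (~` rim) p `<=` core.
Proof.
move=> cp.
pose ext := ~` between.
have sep : separated core ext.
  split; apply/seteqP; split=> q // [].
    move=> clq nq; apply: nq.
    have : core `<=` between by rewrite betweenE; right.
    by move=> /closureS /(_ _ clq); rewrite -((closure_id _).1 closed_between).
  move=> cq clq; have [r [nr cr]] := clq core (open_nbhs_nbhs (conj open_core cq)).
  by apply: nr; rewrite betweenE; right.
have cov : connected_component (~` rim) p `<=` core `|` ext.
  move=> q /connected_component_sub nrq.
  have [|nb] := pselect (between q); last by right.
  by rewrite betweenE => -[/nrq//|]; left.
have [//|cext] := connected_subset sep cov (@component_connected _ _ _).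
have : ext p by apply/cext/connected_component_refl/rim_core.
by case; rewrite betweenE; right.
Qed.

Let vertical_ray (s x y : R) : s = 1 \/ s = -1 ->
  (forall t, 0 <= t -> ~ rim (x, y + s * t)) ->
  ~ bounded_set (connected_component (~` rim) (x, y)).
Proof.
move=> s1 nr [M [_ HM]].
pose ray t : R * R := (x, y + s * t).
have cray : continuous ray.
  by apply: continuous_pair; poly_continuous.
have sub : ray @` [set t | 0 <= t] `<=` connected_component (~` rim) (x, y).
  refine (@connected_component_max _ _ _ (x, y) _ _ _).
  - by exists 0; rewrite /= ?lexx// /ray mulr0 addr0.
  - by move=> _ [t /= t0 <-]; exact: nr.
  - apply: connected_continuous_connected; last exact: continuous_subspaceT.
    apply/connected_intervalP => u v /= u0 v0 w /andP[uw _]; exact: le_trans uw.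
pose t := `|M| + 2 + `|y|.
have t0 : 0 <= t by rewrite /t !addr_ge0.
have := HM (`|M| + 1) _ (ray t) (sub _ (ex_intro2 _ _ t t0 erefl)).
have -> : M < `|M| + 1 by have := ler_norm M; lra.
move=> /(_ isT) /=; rewrite prod_normE /= ge_max => /andP[_].
rewrite ler_norml /t; have := ler_norm y; have := ler_norm (- y); rewrite normrN.
have := normr_ge0 M; have := normr_ge0 y.
by case: s1 => -> *; lra.
Qed.

(* From a point outside the region one escapes to infinity along a vertical
   half-line: downwards if the point is below the lower graph, upwards in all
   other cases. *)
Let outer_unbounded p : ~ between p ->
  ~ bounded_set (connected_component (~` rim) p).
Proof.
case: p => x y nb.
have [xab|/negP xab] := boolP (a <= x <= b); last first.
  apply: (@vertical_ray 1); first by left.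
  by move=> t _ /rim_between [/xab].
have [lx|lx] := leP (lo x) y.
  have ux : up x < y.
    by rewrite ltNge; apply/negP => ux; apply: nb; split; rewrite //= lx.
  apply: (@vertical_ray 1); first by left.
  by move=> t t0 /rim_between [_ /andP[_ /=]]; lra.
apply: (@vertical_ray (-1)); first by right.
by move=> t t0 /rim_between [_ /andP[/= + _]]; lra.
Qed.

Let graph_arc (f : R -> R) : continuous f ->
  simple_arc R (graph f a b) (a, f a) (b, f b).
Proof.
move=> cf; apply: (@simple_arc_image _ _ (fun x => (x, f x))) => //.
  by apply: continuous_subspaceT; apply: continuous_pair => //; poly_continuous.
by move=> x y _ _ [].
Qed.

Let graphs_meet x y : graph lo a b (x, y) -> graph up a b (x, y) ->
  x = a \/ x = b /\ lo b = up b.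
Proof.
move=> [x1 /= + [<- <-]] [x2 /= _ [-> e]]; rewrite in_itv /= => /andP[ax xb].
have [->|ax'] := eqVneq a x1; [by left|right].
move: xb; rewrite le_eqVlt => /orP[/eqP xb|xb].
  by rewrite -xb e.
by have := @lo_up x1; rewrite e lt_neqAle ax' ax xb ltxx => /(_ isT).
Qed.

Let rim_closed_curve : simple_closed_curve rim.
Proof.
have arc_lo := graph_arc clo.
have := simple_arc_sym (graph_arc cup); rewrite -lo_up_a => arc_up.
move: lo_up_b; rewrite le_eqVlt => /orP[/eqP eb|lb].
  have -> : rim = graph lo a b `|` graph up a b.
    apply/setUidPl => _ [y /= + <-]; rewrite in_itv /= eb -eq_le => /eqP <-.
    by right; exists b; rewrite //= in_itv /= lexx ltW.
  rewrite -eb in arc_up; apply: simple_closed_cat arc_lo arc_up _ => -[x y] [lxy uxy].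
  have -> : y = lo x by case: lxy => z _ [-> ->].
  by have [->|[-> _]] := graphs_meet lxy uxy; [left|right].
pose side y : R * R := (b, y).
have arc_side : simple_arc R (vertical_side b (lo b) (up b)) (b, lo b) (b, up b).
  apply: (@simple_arc_image _ _ side) => //; last by move=> ? ? _ _ [].
  by apply: continuous_subspaceT; apply: continuous_pair; poly_continuous.
have arc := simple_arc_cat arc_lo arc_side.
rewrite /rim setUAC; apply: simple_closed_cat (arc _) arc_up _.
  by move=> _ [[x _ <-] [y _ [<- _]]].
move=> [x y] [[lxy|[z _ [<- <-]]] uxy].
  have [e|[_ e]] := graphs_meet lxy uxy; last by rewrite e ltxx in lb.
  by left; case: lxy => t _ [te <-]; rewrite te e.
by right; case: uxy => t _ [-> ->].
Qed.

(** The inside of the rim is found without the Jordan curve theorem: points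
    strictly between the graphs are trapped, all others reach infinity along a
    vertical half-line. *)
Lemma region_between : region_bounded_by rim between.
Proof.
split=> //; rewrite betweenE; apply/seteqP; split=> p [rp|].
- by left.
- move=> cp; right; split; first exact: rim_core.
  have [M [Mr HM]] := bounded_core.
  by exists M; split=> // e /HM He q /(component_core cp)/He.
- by left.
- move=> [nr bp]; right.
  have : between p by apply: contrapT => nb; exact: (outer_unbounded nb bp).
  by rewrite betweenE => -[].
Qed.

End RegionBetweenGraphs.

(** * Connecting orbits of scalar equations *)

Section ScalarOrbits.
Variables (R : realType) (u m : R).

(** Separation of variables. The primitive T of 1/g is the time at which the
    orbit passes a point, so the orbit is the inverse function of T; it is
    defined for all times because T is onto, and it tends to the end points
    because it is increasing with range ]u, m[. *)
Lemma connecting_orbit (g T : R -> R) :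
  u < m ->
  (forall s, u < s < m -> 0 < g s) ->
  (forall s : R, u < s < m -> is_derive s 1 T (g s)^-1) ->
  (forall t, exists2 s, u < s < m & T s = t) ->
  exists x : R -> R, [/\ forall t, u < x t < m,
    forall t : R, is_derive t 1 x (g (x t)),
    x t @[t --> -oo] --> u & x t @[t --> +oo] --> m].
Proof.
move=> um g0 dT surjT.
have cT s : u < s < m -> {for s, continuous T}.
  by move=> /dT [/derivable1_diffP/differentiable_continuous].
have Tlt s1 s2 : u < s1 < m -> u < s2 < m -> s1 < s2 -> T s1 < T s2.
  move=> h1 h2; apply: (@gtr0_derive1_lt_oo R T u m); rewrite ?in_itv //=.
  - by move=> s; rewrite in_itv /= => /dT[].
  - move=> s; rewrite in_itv /= => hs; rewrite derive1E.
    by have [_ ->] := dT _ hs; rewrite invr_gt0 g0.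
  - by move=> s; rewrite inE /= in_itv /= => /cT.
have [x xP] : {x : R -> R & forall t, u < x t < m /\ T (x t) = t}.
  by apply: (@choice _ _ (fun t s => u < s < m /\ T s = t)) => t;
    have [s ? ?] := surjT t; exists s.
have xin t : u < x t < m by have [] := xP t.
have Tx t : T (x t) = t by have [] := xP t.
have lt_x s t : u < s < m -> T s < t -> s < x t.
  move=> hs; rewrite ltNge => /negP st; rewrite ltNge; apply/negP => xs.
  apply: st; move: xs; rewrite le_eqVlt => /orP[/eqP <-|xs]; first by rewrite Tx.
  by rewrite -(Tx t) ltW // Tlt.
have x_lt s t : u < s < m -> t < T s -> x t < s.
  move=> hs; rewrite ltNge => /negP st; rewrite ltNge; apply/negP => xs.
  apply: st; move: xs; rewrite le_eqVlt => /orP[/eqP ->|xs]; first by rewrite Tx.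
  by rewrite -(Tx t) ltW // Tlt.
have xT s : u < s < m -> x (T s) = s.
  move=> hs; apply/eqP; rewrite eq_le !leNgt; apply/andP; split; apply/negP => h.
    by have := Tlt _ _ hs (xin _) h; rewrite Tx ltxx.
  by have := Tlt _ _ (xin _) hs h; rewrite Tx ltxx.
have near_in t : \forall s \near x t, u < s < m.
  by have := @near_in_itvoo R u m (x t); rewrite !in_itv /=; apply.
exists x; split=> //.
- move=> t; rewrite -{1}(Tx t) -[g _]invrK.
  apply: is_derive_inverse; last by rewrite invr_eq0 gt_eqF // g0.
  + by apply: filterS (near_in t) => s; exact: xT.
  + by apply: filterS (near_in t) => s; exact: cT.
  + exact: dT.
- apply/cvgrPdist_lt => e e0.
  pose s := Num.min (u + e) ((u + m) / 2).
  have hs : u < s < m by rewrite /s lt_min gt_min; apply/andP; split;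
    [apply/andP; split|apply/orP; right]; lra.
  near=> t; have : x t < s.
    by apply: x_lt => //; near: t; apply: nbhs_ninfty_lt; exact: num_real.
  rewrite lt_min => /andP[? _]; have /andP[? _] := xin t.
  by rewrite ltr_norml; lra.
- apply/cvgrPdist_lt => e e0.
  pose s := Num.max (m - e) ((u + m) / 2).
  have hs : u < s < m by rewrite /s gt_max lt_max; apply/andP; split;
    [apply/orP; right|apply/andP; split]; lra.
  near=> t; have : s < x t.
    by apply: lt_x => //; near: t; apply: nbhs_pinfty_gt; exact: num_real.
  rewrite gt_max => /andP[? _]; have /andP[_ ?] := xin t.
  by rewrite ltr_norml; lra.
Unshelve. all: by end_near.
Qed.

(** The logarithms produced by simple zeros of the field at u and m make the
    passage time range over the whole line. *)
Lemma log_time_onto (A B K : R) (W : R -> R) : u < m -> 0 < A -> 0 < B ->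
  (forall s, u < s < m -> `|W s| <= K) ->
  (forall s, u < s < m -> {for s, continuous W}) ->
  forall t, exists2 s, u < s < m & A * ln (s - u) - B * ln (m - s) + W s = t.
Proof.
move=> um A0 B0 WK cW t.
pose T s := A * ln (s - u) - B * ln (m - s) + W s.
pose d := (m - u) / 2; have d0 : 0 < d by rewrite /d; lra.
pose X := (`|t| + `|A * ln d| + `|B * ln d| + K).
have K0 : 0 <= K by apply: le_trans (WK ((u + m) / 2) _) => //; lra.
have X0 : 0 <= X by rewrite /X !addr_ge0.
(* Offsets from u and m at which the corresponding logarithm outweighs t and
   all the terms that stay bounded there. *)
pose y1 := d * expR (- (X / A)); pose y2 := d * expR (- (X / B)).
have E1 : expR (- (X / A)) <= 1 by rewrite -expR0 ler_expR oppr_le0 divr_ge0 // ltW.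
have E2 : expR (- (X / B)) <= 1 by rewrite -expR0 ler_expR oppr_le0 divr_ge0 // ltW.
have y10 : 0 < y1 by rewrite mulr_gt0 ?expR_gt0.
have y20 : 0 < y2 by rewrite mulr_gt0 ?expR_gt0.
have y1d : y1 <= d by rewrite ger_pMr.
have y2d : y2 <= d by rewrite ger_pMr.
have ln1 : A * ln y1 = A * ln d - X.
  by rewrite lnM ?posrE ?expR_gt0 // expRK mulrDr mulrN mulrCA divff ?gt_eqF // mulr1.
have ln2 : B * ln y2 = B * ln d - X.
  by rewrite lnM ?posrE ?expR_gt0 // expRK mulrDr mulrN mulrCA divff ?gt_eqF // mulr1.
have dE : m - u = d + d by rewrite /d; lra.
have s1in : u < u + y1 < m by lra.
have s2in : u < m - y2 < m by lra.
have T1 : T (u + y1) <= t.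
  have W1 := WK _ s1in.
  have l1 : B * ln d <= B * ln (m - (u + y1)).
    by rewrite ler_pM2l // ler_ln ?posrE; lra.
  rewrite /T (_ : u + y1 - u = y1) ?ln1; last by lra.
  move: W1 l1; rewrite ler_norml /X => /andP[_ ?] ?.
  have := ler_norm (- t); have := ler_norm (A * ln d);
    have := ler_norm (- (B * ln d)); rewrite !normrN; lra.
have T2 : t <= T (m - y2).
  have W1 := WK _ s2in.
  have l1 : A * ln d <= A * ln (m - y2 - u).
    by rewrite ler_pM2l // ler_ln ?posrE; lra.
  rewrite /T (_ : m - (m - y2) = y2) ?ln2; last by lra.
  move: W1 l1; rewrite ler_norml /X => /andP[? _] ?.
  have := ler_norm t; have := ler_norm (- (A * ln d));
    have := ler_norm (B * ln d); rewrite !normrN; lra.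
have cT : {within `[u + y1, m - y2], continuous T}.
  apply: continuous_in_subspaceT => s; rewrite inE /= in_itv /= => /andP[s1 s2].
  rewrite /continuous_at /T; apply: cvgD; last by apply: cW; lra.
  apply: cvgB; apply: cvgM; try exact: cvg_cst.
    apply: (continuous_comp (f := fun s => s - u)).
      by apply: cvgB; [exact: cvg_id|exact: cvg_cst].
    by apply: continuous_ln; lra.
  apply: (continuous_comp (f := fun s => m - s)).
    by apply: cvgB; [exact: cvg_cst|exact: cvg_id].
  by apply: continuous_ln; lra.
have [||s + sT] := IVT _ cT (v := t).
- by lra.
- by rewrite ge_min le_max T1 T2 orbT.
- by rewrite in_itv /= => /andP[? ?]; exists s => //; lra.
Qed.

End ScalarOrbits.

(** * Speeds along the invariant line *)

Section LineAlgebra.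
Variables (R : realType) (nu : R).
Hypothesis nu_gt8 : 8 < nu.
Implicit Types u s m x y : R.

(** On the line the flux is s^2 / den s. Its derivative, the characteristic
    speed along the line, is speed_b; the other eigenvalue, with eigenvector
    transverse to the line, is speed_a; chord u m is the slope of the chord of
    the flux, that is the Rankine-Hugoniot speed. *)
Definition den x : R := x ^+ 2 + nu * (1 - x) ^+ 2.
Definition speed_a x : R := 2 * x / den x.
Definition speed_b x : R := 2 * nu * x * (1 - x) / den x ^+ 2.
Definition chord u m : R := nu * (u + m - 2 * u * m) / (den u * den m).

(** The umbilic point, where speed_a and speed_b coincide. *)
Definition s_umb : R := nu / (1 + nu).

(** For each m there is exactly one u such that the chord from u to m has the
    speed speed_a u; it is ext m, see chord_speed_a. *)
Definition ext_den x : R := 2 * (1 + nu) * x ^+ 2 - 2 * nu * x + nu.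
Definition ext x : R := nu * x / ext_den x.

(** Up to a factor of constant sign this is the second divided difference of
    the flux at u, s, m, see chord_sub. *)
Definition concavity u s m : R :=
  (1 + nu) * (u * s + u * m + s * m - 2 * u * s * m) - nu.

(** A lower bound for all left states in play, large enough for ext to be
    decreasing beyond it. *)
Definition s_min : R := 3 * nu / (4 * (1 + nu)).

(** The larger solution u of ext u = m, a quadratic equation in u. *)
Definition ext_inv m : R :=
  (nu * (m^-1 + 2) + Num.sqrt ((nu * (m^-1 + 2)) ^+ 2 - 8 * nu * (1 + nu)))
    / (4 * (1 + nu)).

Let nu0 : 0 < nu. Proof. by have := nu_gt8; lra. Qed.
Let nu10 : 0 < 1 + nu. Proof. by have := nu_gt8; lra. Qed.

Lemma den_gt0 x : 0 < den x.
Proof.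
rewrite -(pmulr_rgt0 _ nu10).
have -> : (1 + nu) * den x = ((1 + nu) * x - nu) ^+ 2 + nu by rewrite /den; ring.
by rewrite ltr_wpDl ?sqr_ge0.
Qed.

Lemma ext_den_gt0 x : 0 < ext_den x.
Proof.
have a0 : 0 < 2 * (1 + nu) by rewrite mulr_gt0.
rewrite -(pmulr_rgt0 _ a0).
have -> : 2 * (1 + nu) * ext_den x =
    (2 * (1 + nu) * x - nu) ^+ 2 + nu * (2 + nu) by rewrite /ext_den; ring.
by rewrite ltr_wpDl ?sqr_ge0// mulr_gt0// ltr_wpDl.
Qed.

Lemma den_neq0 x : den x != 0. Proof. by rewrite gt_eqF // den_gt0. Qed.
Lemma ext_den_neq0 x : ext_den x != 0. Proof. by rewrite gt_eqF // ext_den_gt0. Qed.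

Lemma chordC u m : chord u m = chord m u.
Proof. by rewrite /chord; congr (_ / _); ring. Qed.

Lemma chord_diag x : chord x x = speed_b x.
Proof. by rewrite /chord /speed_b expr2; congr (_ / _); ring. Qed.

(** The comparison of the chord speed with the transverse eigenvalue at one end
    only depends on the position of that end relative to ext of the other end.
    As the chord is symmetric, the same function ext describes the end states
    that are characteristic on the left and those that are so on the right. *)
Lemma chord_speed_a u m :
  chord u m - speed_a u = ext_den m / (den u * den m) * (ext m - u).
Proof.
have := den_neq0 u; have := den_neq0 m; have := ext_den_neq0 m.
move=> qm dm du; have -> : ext m - u =
    (nu * (u + m - 2 * u * m) - 2 * u * den m) / ext_den m.
  rewrite [X in X / _](_ : _ = nu * m - u * ext_den m); last by rewrite /ext_den /den; ring.
  by rewrite /ext; field.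
by rewrite /chord /speed_a; field; rewrite qm dm du.
Qed.

Let weight_gt0 u m : 0 < ext_den m / (den u * den m).
Proof. by rewrite divr_gt0 ?mulr_gt0 ?den_gt0 ?ext_den_gt0. Qed.

Lemma speed_a_le_chord u m : (speed_a u <= chord u m) = (u <= ext m).
Proof. by rewrite -subr_ge0 chord_speed_a pmulr_rge0 // subr_ge0. Qed.

Lemma chord_le_speed_a u m : (chord u m <= speed_a u) = (ext m <= u).
Proof. by rewrite -subr_le0 chord_speed_a pmulr_rle0 // subr_le0. Qed.

Lemma chord_lt_speed_a u m : (chord u m < speed_a u) = (ext m < u).
Proof. by rewrite !ltNge speed_a_le_chord. Qed.

Lemma chord_eq_speed_a u m : (chord u m == speed_a u) = (u == ext m).
Proof. by rewrite !eq_le chord_le_speed_a speed_a_le_chord andbC. Qed.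

Lemma chord_ext m : chord (ext m) m = speed_a (ext m).
Proof. by apply/eqP; rewrite chord_eq_speed_a. Qed.

(** The factors show that 2 separates the two sides of the umbilic point:
    speed_a is below 2 on its left and at least 2 on its right up to s = 1, with
    equality at the umbilic point and at s = 1. *)
Lemma speed_a_sub2 x : speed_a x - 2 = 2 * ((1 - x) * ((1 + nu) * x - nu)) / den x.
Proof.
by have := den_neq0 x; rewrite /speed_a /den => dx; field.
Qed.

Lemma s_umb_gt x : (s_umb < x) = (0 < (1 + nu) * x - nu).
Proof. by rewrite /s_umb ltr_pdivrMr // subr_gt0 mulrC. Qed.

Lemma s_umb_lt1 : s_umb < 1.
Proof. by rewrite /s_umb ltr_pdivrMr // mul1r; lra. Qed.

Lemma speed_a_ge2 x : s_umb <= x -> x <= 1 -> 2 <= speed_a x.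
Proof.
move=> ux x1; rewrite -subr_ge0 speed_a_sub2; apply: divr_ge0; last exact/ltW/den_gt0.
apply: mulr_ge0 => //; apply: mulr_ge0; first by rewrite subr_ge0.
by rewrite subr_ge0 mulrC -ler_pdivrMr.
Qed.

Lemma speed_a_lt2 x : x < s_umb -> speed_a x < 2.
Proof.
move=> xu; rewrite -subr_lt0 speed_a_sub2 -mulrA pmulr_rlt0 //.
rewrite pmulr_llt0 ?invr_gt0 ?den_gt0 // pmulr_rlt0 ?subr_gt0.
  by rewrite subr_lt0 mulrC -ltr_pdivlMr.
by apply: lt_trans s_umb_lt1.
Qed.

Lemma speed_a_umb : speed_a s_umb = 2.
Proof.
have e : (1 + nu) * s_umb = nu by rewrite /s_umb mulrCA divff ?mulr1 ?gt_eqF.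
by apply/eqP; rewrite -subr_eq0 speed_a_sub2 e subrr !(mulr0, mul0r).
Qed.

Lemma speed_a1 : speed_a 1 = 2.
Proof.
by apply/eqP; rewrite -subr_eq0 speed_a_sub2 subrr !(mul0r, mulr0).
Qed.

Lemma speed_a_sub_b x : speed_a x - speed_b x =
  2 * x ^+ 2 * ((1 + nu) * x - nu) / den x ^+ 2.
Proof.
have d0 := den_neq0 x.
have -> : 2 * x ^+ 2 * ((1 + nu) * x - nu) =
    2 * x * den x - 2 * nu * x * (1 - x) by rewrite /den; ring.
by rewrite /speed_a /speed_b; field.
Qed.

Lemma speed_a_le_b x : x <= s_umb -> speed_a x <= speed_b x.
Proof.
move=> xu; rewrite -subr_le0 speed_a_sub_b pmulr_lle0 ?invr_gt0 ?exprn_gt0 ?den_gt0 //.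
apply: mulr_ge0_le0; first by apply: mulr_ge0 => //; exact: sqr_ge0.
by rewrite subr_le0 mulrC -ler_pdivlMr.
Qed.

Lemma speed_b_le_a x : s_umb <= x -> speed_b x <= speed_a x.
Proof.
move=> xu; rewrite -subr_ge0 speed_a_sub_b pmulr_lge0 ?invr_gt0 ?exprn_gt0 ?den_gt0 //.
apply: mulr_ge0; first by apply: mulr_ge0 => //; exact: sqr_ge0.
by rewrite subr_ge0 mulrC -ler_pdivrMr.
Qed.

Lemma ext_umb : ext s_umb = s_umb.
Proof.
have := ext_den_neq0 s_umb; rewrite /ext /ext_den /s_umb => q0.
rewrite (_ : _ - _ + nu = nu); first by rewrite mulrAC divff ?mul1r ?gt_eqF.
by field; rewrite gt_eqF.
Qed.

Lemma ext1 : ext 1 = nu / (2 + nu).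
Proof. by rewrite /ext /ext_den; congr (_ / _); ring. Qed.

Lemma s_min_umb : s_min < s_umb.
Proof.
rewrite /s_min /s_umb ltr_pdivrMr ?mulr_gt0 // mulrAC ltr_pdivlMr //.
by have := mulr_gt0 nu0 nu10; lra.
Qed.

Lemma s_min_gt0 : 0 < s_min.
Proof. by rewrite /s_min divr_gt0 ?mulr_gt0. Qed.

Lemma s_min_le_ext1 : s_min <= ext 1.
Proof.
have := nu_gt8 => n8.
rewrite ext1 /s_min ler_pdivrMr ?mulr_gt0 // mulrAC ler_pdivlMr; last by lra.
by nra.
Qed.

(** At x = y = s_min the inequality is equivalent to nu > 8. *)
Lemma s_min_mul x y : s_min <= x -> s_min <= y -> nu < 2 * (1 + nu) * (x * y).
Proof.
move=> hx hy; apply: (@lt_le_trans _ _ (2 * (1 + nu) * (s_min * s_min))).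
  rewrite (_ : 2 * _ * _ = nu * (9 * nu / (8 * (1 + nu)))).
    rewrite ltr_pMr // ltr_pdivlMr ?mulr_gt0 //; have := nu_gt8; lra.
  by rewrite /s_min; field; rewrite gt_eqF.
by rewrite ler_pM2l ?mulr_gt0 //; apply: ler_pM => //; exact/ltW/s_min_gt0.
Qed.

(** Together with s_min_mul, this factorization shows that ext decreases. *)
Lemma ext_sub x y : ext x - ext y =
  nu * ((y - x) * (2 * (1 + nu) * (x * y) - nu)) / (ext_den x * ext_den y).
Proof.
have := ext_den_neq0 x; have := ext_den_neq0 y; rewrite /ext => qy qx.
rewrite -mulNr addf_div //; congr (_ / _); rewrite /ext_den; ring.
Qed.

Lemma ext_decr x y : s_min <= x -> s_min <= y -> x < y -> ext y < ext x.
Proof.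
move=> hx hy xy; rewrite -subr_gt0 ext_sub divr_gt0 ?mulr_gt0 ?ext_den_gt0 ?subr_gt0 //.
exact: s_min_mul.
Qed.

Lemma ext_ltP x y : s_min <= x -> s_min <= y -> (ext y < ext x) = (x < y).
Proof.
move=> hx hy; apply/idP/idP => [|/ext_decr]; last exact.
rewrite ltNge => xy; rewrite ltNge; apply: contra xy.
by rewrite le_eqVlt => /orP[/eqP->//|/ext_decr/ltW]; exact.
Qed.

Lemma ext_leP x y : s_min <= x -> s_min <= y -> (ext y <= ext x) = (x <= y).
Proof. by move=> hx hy; rewrite !leNgt ext_ltP. Qed.

Lemma ext_inj x y : s_min <= x -> s_min <= y -> ext x = ext y -> x = y.
Proof.
by move=> hx hy e; apply/eqP; rewrite eq_le -(ext_leP hx hy) -(ext_leP hy hx) e lexx.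
Qed.

Lemma ext_range m : s_umb < m -> m <= 1 -> ext 1 <= ext m < s_umb.
Proof.
move=> um m1; have hm : s_min <= m by rewrite ltW // (lt_trans s_min_umb).
rewrite -[X in _ < X]ext_umb ext_leP ?ext_ltP ?(ltW s_min_umb) ?um ?m1 //.
exact: le_trans m1.
Qed.

(** The discriminant is smallest at m = 1, where it equals nu (nu - 8). *)
Lemma ext_invK m : 0 < m -> m <= 1 -> ext (ext_inv m) = m /\ s_min <= ext_inv m.
Proof.
move=> m0 m1; have := nu_gt8 => n8.
have m'1 : 1 <= m^-1 by rewrite invf_ge1.
pose r := nu * (m^-1 + 2); have r3 : 3 * nu <= r by rewrite /r; nra.
pose q := Num.sqrt (r ^+ 2 - 8 * nu * (1 + nu)).
have q0 : 0 <= q by exact: sqrtr_ge0.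
have q2 : q ^+ 2 = r ^+ 2 - 8 * nu * (1 + nu) by rewrite sqr_sqrtr //; nra.
have eE : ext_inv m = (r + q) / (4 * (1 + nu)) by [].
have a0 : 1 + nu != 0 by rewrite gt_eqF.
have e_ge : s_min <= ext_inv m.
  by rewrite eE /s_min ler_pM2r ?invr_gt0 ?mulr_gt0 //; lra.
split=> //; have e0 : ext_inv m != 0 by rewrite gt_eqF // (lt_le_trans s_min_gt0).
have root : 2 * (1 + nu) * ext_inv m ^+ 2 = r * ext_inv m - nu.
  have rq : (r + q) ^+ 2 = 2 * r * (r + q) - 8 * nu * (1 + nu).
    by rewrite sqrrD q2; ring.
  by rewrite eE expr_div_n rq; field.
rewrite /ext (_ : ext_den _ = nu * ext_inv m / m); last by rewrite /ext_den root /r; ring.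
by field; rewrite e0 !gt_eqF.
Qed.

Lemma ext_inv1 : ext_inv 1 =
  (3 * nu + Num.sqrt (nu * (nu - 8))) / (4 * (nu + 1)).
Proof.
rewrite /ext_inv invr1 [nu + 1]addrC; congr ((_ + Num.sqrt _) / _); ring.
Qed.

(** The chord from u flattens when its other end moves right, as long as
    concavity stays positive: this one identity gives the monotonicity of the
    chord speed, the strict shock inequalities (with two equal arguments) and
    the sign of the travelling wave field. *)
Lemma chord_sub u s m : chord u s - chord u m =
  nu * ((m - s) * concavity u s m) / (den u * (den s * den m)).
Proof.
have := den_neq0 u; have := den_neq0 s; have := den_neq0 m.
have -> : nu * ((m - s) * concavity u s m) =
    nu * (u + s - 2 * u * s) * den m - nu * (u + m - 2 * u * m) * den s.
  by rewrite /concavity /den; ring.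
by rewrite /chord => dm ds du; field; rewrite dm ds du.
Qed.

Lemma concavityC u s m : concavity u s m = concavity u m s.
Proof. by rewrite /concavity; ring. Qed.
Lemma concavityCA u s m : concavity u s m = concavity s u m.
Proof. by rewrite /concavity; ring. Qed.

Lemma concavity_incr u s m m' : 0 <= u <= 1 -> 0 <= s <= 1 -> m <= m' ->
  concavity u s m <= concavity u s m'.
Proof.
move=> /andP[u0 u1] /andP[s0 s1] mm; rewrite -subr_ge0.
have -> : concavity u s m' - concavity u s m =
    (1 + nu) * ((m' - m) * (u * (1 - s) + s * (1 - u))) by rewrite /concavity; ring.
by rewrite !mulr_ge0 ?subr_ge0 ?addr_ge0 ?mulr_ge0 ?subr_ge0 // ltW.
Qed.

(** The factorization that yields positivity: the first factor is positive
    exactly where ext decreases. *)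
Lemma concavity_ext u : concavity u u (ext u) =
  (2 * (1 + nu) * (u * u) - nu) * den u / ext_den u.
Proof.
apply: (mulIf (ext_den_neq0 u)); rewrite [RHS]divfK ?ext_den_neq0 //.
have -> : concavity u u (ext u) * ext_den u = ((1 + nu) * u ^+ 2 - nu) * ext_den u +
   2 * (1 + nu) * u * (1 - u) * (ext u * ext_den u) by rewrite /concavity; ring.
by rewrite /ext divfK ?ext_den_neq0 // /ext_den /den; ring.
Qed.

(** It suffices to test concavity at the smallest admissible m, namely ext u. *)
Lemma concavity_gt0 u m : s_min <= u -> u <= 1 -> ext u <= m ->
  0 < concavity u u m.
Proof.
move=> su u1 um; have u0 := lt_le_trans s_min_gt0 su.
apply: (@lt_le_trans _ _ (concavity u u (ext u))).
  by rewrite concavity_ext divr_gt0 ?mulr_gt0 ?den_gt0 ?ext_den_gt0 // subr_gt0 s_min_mul.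
by apply: concavity_incr => //; rewrite (ltW u0) u1.
Qed.

Lemma ext_gt_umb u : s_min <= u -> u < s_umb -> s_umb < ext u.
Proof.
by move=> su uu; rewrite -[X in X < _]ext_umb ext_ltP // ltW // s_min_umb.
Qed.

Lemma ext_invE m u : 0 < m -> m <= 1 -> s_min <= u ->
  (ext_inv m <= u) = (ext u <= m).
Proof.
by move=> m0 m1 su; have [e se] := ext_invK m0 m1; rewrite -[in RHS]e ext_leP.
Qed.

Lemma extK u : s_min <= u -> 0 < ext u -> ext u <= 1 -> ext_inv (ext u) = u.
Proof.
by move=> su e0 e1; have [e se] := ext_invK e0 e1; exact: ext_inj.
Qed.

Lemma s_umb_gt0 : 0 < s_umb. Proof. exact: lt_trans s_min_gt0 s_min_umb. Qed.

Lemma chord_ext_inv m : 0 < m -> m <= 1 -> chord (ext_inv m) m = speed_a m.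
Proof.
move=> m0 m1; have [e _] := ext_invK m0 m1.
by have := chord_ext (ext_inv m); rewrite e chordC.
Qed.

Lemma ext_inv_lt_umb m : s_umb < m -> m <= 1 -> ext_inv m < s_umb.
Proof.
move=> um m1; have [e se] := ext_invK (lt_trans s_umb_gt0 um) m1.
by rewrite -(ext_ltP se (ltW s_min_umb)) e ext_umb.
Qed.

(** The chord from ext m to m has the speed of the transverse eigenvalue at
    ext m, which is below 2, hence below that at m. *)
Lemma ext_ext_lt m : s_umb < m -> m <= 1 -> ext (ext m) < m.
Proof.
move=> um m1; have /andP[_ eu] := ext_range um m1.
rewrite -chord_lt_speed_a chordC chord_ext.
exact: lt_le_trans (speed_a_lt2 eu) (speed_a_ge2 (ltW um) m1).
Qed.

Lemma ext_inv_lt_ext m : s_umb < m -> m <= 1 -> ext_inv m < ext m.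
Proof.
move=> um m1; have [e se] := ext_invK (lt_trans s_umb_gt0 um) m1.
have /andP[e1 _] := ext_range um m1.
rewrite -(ext_ltP se); first by rewrite e ext_ext_lt.
exact: le_trans s_min_le_ext1 e1.
Qed.

Lemma chord_gt0 u m : 0 <= u -> u < 1 -> 0 < m -> m <= 1 -> 0 < chord u m.
Proof.
move=> u0 u1 m0 m1; rewrite /chord divr_gt0 ?mulr_gt0 ?den_gt0 //.
have -> : u + m - 2 * u * m = u * (1 - m) + m * (1 - u) by ring.
by rewrite ltr_wpDl ?mulr_ge0 ?mulr_gt0 ?subr_ge0 ?subr_gt0.
Qed.

Lemma chord_lt u s m : s < m -> 0 < concavity u s m -> chord u m < chord u s.
Proof.
move=> sm tr; rewrite -subr_gt0 chord_sub.
apply: divr_gt0; last by rewrite !mulr_gt0 ?den_gt0.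
by apply: mulr_gt0 => //; apply: mulr_gt0 => //; rewrite subr_gt0.
Qed.

Lemma chord_decr_r u m m' : s_min <= u -> u < s_umb -> ext u <= m -> m < m' ->
  m' <= 1 -> chord u m' < chord u m.
Proof.
move=> su uu um mm m1; have u0 := lt_le_trans s_min_gt0 su.
have um' := lt_le_trans (ext_gt_umb su uu) um.
have uI : 0 <= u <= 1 by rewrite !ltW // (lt_trans uu s_umb_lt1).
have mI : 0 <= m <= 1 by rewrite !ltW ?(lt_le_trans mm) ?(lt_trans s_umb_gt0).
apply: chord_lt => //; apply: (@lt_le_trans _ _ (concavity u m u)); last first.
  apply: concavity_incr => //; exact/ltW/(lt_trans uu)/(lt_trans um').
by rewrite concavityC; apply: concavity_gt0 => //; case/andP: uI.
Qed.

Lemma chord_decr_l u u' m : s_min <= u -> u < u' -> u' < s_umb -> ext u <= m ->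
  m <= 1 -> chord u' m < chord u m.
Proof.
move=> su uu uu' um m1; have u0 := lt_le_trans s_min_gt0 su.
have um' := lt_le_trans (ext_gt_umb su (lt_trans uu uu')) um.
have uI : 0 <= u <= 1 by rewrite !ltW // (lt_trans (lt_trans uu uu') s_umb_lt1).
have mI : 0 <= m <= 1 by rewrite m1 ltW // (lt_trans s_umb_gt0).
rewrite !(chordC _ m); apply: chord_lt => //.
apply: (@lt_le_trans _ _ (concavity m u u)); last exact/concavity_incr/ltW.
by rewrite concavityCA concavityC; apply: concavity_gt0 => //; case/andP: uI.
Qed.

End LineAlgebra.

(** * Travelling waves along the line *)

Section LineOrbits.
Variables (R : realType) (nu : R).
Hypothesis nu_gt8 : 8 < nu.
Implicit Types u s m x y : R.

Let nu0 : 0 < nu. Proof. by have := nu_gt8; lra. Qed.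

Local Notation den := (den nu).
Local Notation chord := (chord nu).
Local Notation concavity := (concavity nu).

Definition flux x : R := x ^+ 2 / den x.

Lemma flux_sub s u : flux s - flux u = chord u s * (s - u).
Proof.
have := den_neq0 nu_gt8 u; have := den_neq0 nu_gt8 s => ds du.
have e : s ^+ 2 * den u - u ^+ 2 * den s = nu * (u + s - 2 * u * s) * (s - u).
  by rewrite /den; ring.
rewrite [RHS](_ : _ = nu * (u + s - 2 * u * s) * (s - u) / (den u * den s)).
  by rewrite -e /flux; field; rewrite ds du.
by rewrite /chord; field; rewrite ds du.
Qed.

Definition line_field u m s : R := flux s - flux u - chord u m * (s - u).

Lemma line_fieldE u m s : line_field u m s =
  nu * ((s - u) * (m - s) * concavity u s m) / (den u * (den s * den m)).
Proof.
rewrite /line_field flux_sub -mulrBl chord_sub //.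
by rewrite mulrAC; congr (_ / _); ring.
Qed.

(** The decomposition of the reciprocal of the field of the travelling wave: a
    quadratic polynomial over a product of three linear factors. *)
Lemma partial_fractions (a d1 d0 p b u m s : R) : m - u != 0 -> s - u != 0 ->
  m - s != 0 -> p + b * s != 0 -> p + b * u != 0 -> p + b * m != 0 ->
  let D x := a * x ^+ 2 + d1 * x + d0 in let L x := p + b * x in
  let A := D u / ((m - u) * L u) in let B := D m / ((m - u) * L m) in
  A / (s - u) + B / (m - s) + (b * (B - A) - a) / L s =
  D s / ((s - u) * (m - s) * L s).
Proof.
by move=> mu su ms Ls Lu Lm /=; field; rewrite mu su ms Ls Lu Lm.
Qed.

Lemma is_derive_comp_ln (f : R -> R) (x df : R) : 0 < f x ->
  is_derive x 1 f df -> is_derive x 1 (fun y => ln (f y)) (df / f x).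
Proof.
move=> fx0 fd; have l := is_derive1_ln fx0.
by have := @is_derive1_comp R (@ln R) f x _ _ l fd; rewrite mulrC.
Qed.

(** The field has simple zeros at u and m and, concavity being positive, no
    other zero between them. The sign of concavity u u m controls the whole interval
    because concavity increases in each argument. *)
Lemma line_orbit u m : 0 <= u -> m <= 1 -> u < m -> 0 < concavity u u m ->
  exists x : R -> R, [/\ forall t, u < x t < m,
    forall t : R, is_derive t 1 x (line_field u m (x t)),
    x t @[t --> -oo] --> u & x t @[t --> +oo] --> m].
Proof.
move=> u0 m1 um tr0.
have dg := @den_gt0 R nu nu_gt8.
pose a := 1 + nu; have a0 : 0 < a by have := nu_gt8; rewrite /a; lra.
pose b := a * (u + m - 2 * u * m); pose p := a * (u * m) - nu.
have b0 : 0 < b by rewrite mulr_gt0 //; nra.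
have LE s : concavity u s m = p + b * s by rewrite /concavity /p /b /a; ring.
have L0 s : u <= s -> 0 < p + b * s.
  move=> us; rewrite LE in tr0; apply: (lt_le_trans tr0).
  by rewrite lerD2l ler_pM2l.
pose K := den u * den m / nu; have K0 : 0 < K by rewrite divr_gt0 ?mulr_gt0.
pose A := K * (den u / ((m - u) * (p + b * u))).
pose B := K * (den m / ((m - u) * (p + b * m))).
have mu0 : 0 < m - u by rewrite subr_gt0.
have A0 : 0 < A by rewrite mulr_gt0 // divr_gt0 // mulr_gt0 // L0.
have B0 : 0 < B by rewrite mulr_gt0 // divr_gt0 // mulr_gt0 // L0 // ltW.
(* C is the residue at the zero of concavity u s m as a function of s. *)
pose C := (b * (B - A) - K * a) / b.
pose W s := C * ln (p + b * s).
apply: (@connecting_orbit R u m (line_field u m)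
  (fun s => A * ln (s - u) - B * ln (m - s) + W s) um).
- move=> s /andP[us sm]; rewrite line_fieldE LE divr_gt0 ?mulr_gt0 ?subr_gt0 //.
  exact/L0/ltW.
- move=> s /andP[us sm].
  have Ls := L0 _ (ltW us); have Lu := L0 _ (lexx u); have Lm := L0 _ (ltW um).
  have su0 : 0 < s - u by rewrite subr_gt0.
  have ms0 : 0 < m - s by rewrite subr_gt0.
  have dl : is_derive s 1 (fun s => s - u) (1 - 0).
    exact: (is_deriveB (is_derive_id s 1) (is_derive_cst u s 1)).
  have dr : is_derive s 1 (fun s => m - s) (0 - 1).
    exact: (is_deriveB (is_derive_cst m s 1) (is_derive_id s 1)).
  have dL : is_derive s 1 (fun s => p + b * s) (0 + b *: 1).
    exact: (is_deriveD (is_derive_cst p s 1) (is_deriveZ b (is_derive_id s 1))).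
  have d1 := is_deriveZ A (@is_derive_comp_ln (fun s => s - u) s _ su0 dl).
  have d2 := is_deriveZ B (@is_derive_comp_ln (fun s => m - s) s _ ms0 dr).
  have d3 := is_deriveZ C (@is_derive_comp_ln (fun s => p + b * s) s _ Ls dL).
  suff <- : A *: ((1 - 0) / (s - u)) - B *: ((0 - 1) / (m - s)) +
      C *: ((0 + b *: 1) / (p + b * s)) = (line_field u m s)^-1.
    exact: (is_deriveD (is_deriveB d1 d2) d3).
  have denE x : a * x ^+ 2 + - 2 * nu * x + nu = den x by rewrite /den /a; ring.
  have := @partial_fractions a (- 2 * nu) nu p b u m s; rewrite /= !denE.
  rewrite !gt_eqF // => /(_ isT isT isT isT isT isT) pf.
  have -> : (line_field u m s)^-1 =
      K * (den s / ((s - u) * (m - s) * (p + b * s))).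
    rewrite line_fieldE LE invf_div /K; field.
    by rewrite !gt_eqF.
  rewrite -pf /C /A /B !(subr0, sub0r, add0r) /GRing.scale /=; field.
  by rewrite !gt_eqF.
- apply: (@log_time_onto R u m A B
    (`|C| * (`|ln (p + b * u)| + `|ln (p + b * m)|)) W um A0 B0).
  + move=> s /andP[us sm]; rewrite /W normrM ler_wpM2l //.
    have Ls := L0 _ (ltW us); have Lu := L0 _ (lexx u); have Lm := L0 _ (ltW um).
    have h1 : ln (p + b * u) <= ln (p + b * s).
      by rewrite ler_ln ?posrE // lerD2l ler_pM2l // ltW.
    have h2 : ln (p + b * s) <= ln (p + b * m).
      by rewrite ler_ln ?posrE // lerD2l ler_pM2l // ltW.
    rewrite ler_norml; have := ler_norm (- ln (p + b * u)).
    have := ler_norm (ln (p + b * m)); rewrite normrN.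
    have := normr_ge0 (ln (p + b * u)); have := normr_ge0 (ln (p + b * m)); lra.
  + move=> s /andP[us sm]; apply: cvgM; first exact: cvg_cst.
    apply: (continuous_comp (f := fun s => p + b * s)).
      apply: cvgD; first exact: cvg_cst.
      by apply: cvgM; [exact: cvg_cst|exact: cvg_id].
    exact/continuous_ln/L0/ltW.
Qed.

Lemma continuous_den : continuous den.
Proof. by rewrite /den; poly_continuous. Qed.

Lemma continuous_speed_a : continuous (speed_a nu).
Proof.
apply: (@continuous_quot _ (fun x => 2 * x) den) => [||x]; first poly_continuous.
  exact: continuous_den.
exact: den_neq0.
Qed.

Lemma continuous_ext : continuous (ext nu).
Proof.
apply: (@continuous_quot _ (fun x => nu * x) (ext_den nu)) => [||x]; first poly_continuous.
  by rewrite /ext_den; poly_continuous.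
exact: ext_den_neq0.
Qed.

Lemma continuous_chord u : continuous (chord u).
Proof.
apply: (@continuous_quot _ (fun m => nu * (u + m - 2 * u * m))
  (fun m => den u * den m)) => [||m]; first poly_continuous.
  apply: (@continuous_mul _ (fun=> den u) den); first poly_continuous.
  exact: continuous_den.
by rewrite mulf_neq0 // den_neq0.
Qed.

Lemma continuous_speed_a_ext : continuous (speed_a nu \o ext nu).
Proof.
by move=> x; apply: continuous_comp;
  [exact: continuous_ext|exact: continuous_speed_a].
Qed.

Lemma continuous_chord_l m : continuous (fun u => chord u m).
Proof.
rewrite (_ : (fun _ => _) = chord m); first exact: continuous_chord.
by apply/funext => u; rewrite chordC.
Qed.

End LineOrbits.

(** * The model restricted to the invariant line *)

Section Derivatives.
Variable R : realType.

Lemma is_derive_sqr_div (f : R -> R) (c x df : R) : is_derive x 1 f df ->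
  is_derive x 1 (fun y => f y ^+ 2 / c) (2 * f x * df / c).
Proof.
move=> fd; suff <- : (f x * f x) *: (0 : R) + c^-1 *: (f x *: df + f x *: df) =
    2 * f x * df / c.
  exact: (is_deriveM (is_deriveM fd fd) (is_derive_cst c^-1 x 1)).
by rewrite /GRing.scale /=; ring.
Qed.

Lemma is_derive_mulr (f : R -> R) (c x df : R) : is_derive x 1 f df ->
  is_derive x 1 (fun y => f y * c) (df * c).
Proof.
move=> fd; suff <- : f x *: (0 : R) + c *: df = df * c.
  exact: (is_deriveM fd (is_derive_cst c x 1)).
by rewrite /GRing.scale /=; ring.
Qed.

Lemma is_derive_div (f g : R -> R) (x df dg : R) : g x != 0 ->
  is_derive x 1 f df -> is_derive x 1 g dg ->
  is_derive x 1 (fun y => f y / g y) ((df * g x - f x * dg) / g x ^+ 2).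
Proof.
move=> g0 fd gd; suff <- : f x *: (- (g x) ^- 2 *: dg) + (g x)^-1 *: df =
    (df * g x - f x * dg) / g x ^+ 2.
  exact: (is_deriveM fd (is_deriveV g0 gd)).
by rewrite /GRing.scale /=; field.
Qed.

Lemma eigenvalue_2x2 (A : 'M[R]_2) (z : R) : eigenvalue A z <->
  (z - A ord0 ord0) * (z - A ord_max ord_max) = A ord0 ord_max * A ord_max ord0.
Proof.
rewrite eigenvalue_root_char rootE /char_poly (expand_det_row _ ord0).
rewrite !big_ord_recl big_ord0 /cofactor !det_mx11 !mxE /=.
rewrite (_ : lift ord0 ord0 = ord_max); last exact/val_inj.
rewrite (_ : lift ord_max ord0 = ord0); last exact/val_inj.
rewrite !add0n /bump leqnn addn0 expr0 expr1 mulr1n !mulr0n !hornerE /=.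
rewrite mulr1 mulrN1 opprK mulrN addr0 subr_eq0.
by split=> [/eqP|->].
Qed.

Lemma inf_set2 (a b : R) : inf [set a; b] = Num.min a b.
Proof.
apply/eqP; rewrite eq_le; apply/andP; split.
  apply: ge_inf; last by case: leP => _; [left|right].
  by exists (Num.min a b) => x [] -> /=; rewrite ge_min lexx ?orbT.
apply: lb_le_inf; first by exists a; left.
by move=> x [] -> /=; rewrite ge_min lexx ?orbT.
Qed.

Lemma sup_set2 (a b : R) : sup [set a; b] = Num.max a b.
Proof.
apply/eqP; rewrite eq_le; apply/andP; split.
  apply: ge_sup; first by exists a; left.
  by move=> x [] -> /=; rewrite le_max lexx ?orbT.
apply: ub_le_sup; last by case: leP => _; [right|left].
by exists (Num.max a b) => x [] -> /=; rewrite le_max lexx ?orbT.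
Qed.

End Derivatives.

Section ModelOnLine.
Variables (R : realType) (mw mo mg : R).
Hypotheses (mw_gt0 : 0 < mw) (mo_gt0 : 0 < mo) (mg_gt0 : 0 < mg).
Hypothesis nu_gt8 : 8 < nu_G mw mo mg.

Local Notation nu := (nu_G mw mo mg).
Implicit Types s t v : R.

Let m_gt0 : 0 < mw + mo. Proof. exact: addr_gt0. Qed.
Let m_neq0 : mw + mo != 0. Proof. by rewrite gt_eqF. Qed.
Let mw_neq0 : mw != 0. Proof. by rewrite gt_eqF. Qed.
Let mo_neq0 : mo != 0. Proof. by rewrite gt_eqF. Qed.
Let mg_neq0 : mg != 0. Proof. by rewrite gt_eqF. Qed.

(** The state with parameter s on the line. *)
Definition pt s : R * R := (s * (mw / (mw + mo)), s * (mo / (mw + mo))).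

Lemma par_pt s : par (pt s) = s.
Proof. by rewrite /par /pt /= -mulrDr -mulrDl divff // mulr1. Qed.

Lemma pt_line s : 0 <= s <= 1 -> line_GD mw mo (pt s).
Proof.
move=> /andP[s0 s1]; split; last by rewrite /pt /=; field; rewrite ?mw_neq0 ?mo_neq0 ?mg_neq0 ?m_neq0.
have := par_pt s; rewrite /par => e.
have w0 : 0 <= mw / (mw + mo) by rewrite divr_ge0 // ltW.
have o0 : 0 <= mo / (mw + mo) by rewrite divr_ge0 // ltW.
by split; rewrite ?e // /pt /= mulr_ge0.
Qed.

Lemma line_pt U : line_GD mw mo U -> U = pt (par U).
Proof.
case: U => x y [_ /= xy]; rewrite /pt /par /=.
have -> : y = x * mo / mw.
  by rewrite -[y](divfK mo_neq0) -xy; field.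
congr (_, _); field; by rewrite ?mw_neq0 ?mo_neq0 ?mg_neq0 ?m_neq0.
Qed.

Lemma line_par U : line_GD mw mo U -> 0 <= par U <= 1.
Proof. by move=> [[U1 U2 U12] _]; rewrite /par addr_ge0. Qed.

Lemma pt1 : pt 1 = vD mw mo.
Proof. by rewrite /pt !mul1r. Qed.

Lemma pt_umb : pt (s_umb nu) = umbilic mw mo mg.
Proof.
have n0 : mw + mo + mg != 0 by rewrite gt_eqF // addr_gt0.
have n0' : mg + (mw + mo) != 0 by rewrite addrC.
by rewrite /pt /umbilic /s_umb /nu_G; congr (_, _); field; rewrite ?m_neq0 ?mg_neq0 ?n0 ?n0'.
Qed.

Lemma par_umb : par (umbilic mw mo mg) = s_umb nu.
Proof. by rewrite -pt_umb par_pt. Qed.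

Lemma total_mobility_pt s :
  total_mobility mw mo mg (pt s) = den nu s / (mw + mo).
Proof.
rewrite /total_mobility /s_g /pt /den /nu_G /=.
by field; rewrite ?mw_neq0 ?mo_neq0 ?mg_neq0 ?m_neq0.
Qed.

Lemma f_w_pt s : f_w mw mo mg (pt s) = mw / (mw + mo) * flux nu s.
Proof.
have d0 := den_neq0 nu_gt8 s.
rewrite /f_w total_mobility_pt /pt /flux /=.
by field; rewrite ?d0 ?mw_neq0 ?mo_neq0 ?mg_neq0 ?m_neq0.
Qed.

Lemma f_o_pt s : f_o mw mo mg (pt s) = mo / (mw + mo) * flux nu s.
Proof.
have d0 := den_neq0 nu_gt8 s.
rewrite /f_o total_mobility_pt /pt /flux /=.
by field; rewrite ?d0 ?mw_neq0 ?mo_neq0 ?mg_neq0 ?m_neq0.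
Qed.

Lemma rankine_hugoniot_pt s t v :
  rankine_hugoniot mw mo mg (pt s) (pt t) v <->
  flux nu t - flux nu s = v * (t - s).
Proof.
have w0 : mw / (mw + mo) != 0 by rewrite mulf_neq0 ?invr_eq0.
rewrite /rankine_hugoniot !f_w_pt !f_o_pt /pt /=; split=> [[h _]|h].
  by apply: (mulfI w0); rewrite mulrBr h; ring.
by rewrite -!mulrBr h; split; ring.
Qed.

Lemma rankine_hugoniot_chord s t :
  rankine_hugoniot mw mo mg (pt s) (pt t) (chord nu s t).
Proof. by rewrite rankine_hugoniot_pt flux_sub. Qed.

Lemma sigma_pt s t : s != t -> sigma mw mo mg (pt s) (pt t) = chord nu s t.
Proof.
move=> st; apply: xget_unique; first exact: rankine_hugoniot_chord.
move=> v /= /rankine_hugoniot_pt; rewrite flux_sub // => /mulIf -> //.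
by rewrite subr_eq0 eq_sym.
Qed.

(** On the line the derivatives of the total mobility in both directions agree,
    so that DF is a multiple of the identity plus a matrix of rank one. *)
Lemma DF_pt s (i j : 'I_2) : DF mw mo mg (pt s) i j =
  let c := if i == ord0 then mw else mo in
  (i == j)%:R * speed_a nu s - c / (mw + mo) * (speed_a nu s - speed_b nu s).
Proof.
have d0 := den_neq0 nu_gt8 s.
pose x := (pt s).1; pose y := (pt s).2.
have T0 : total_mobility mw mo mg (x, y) != 0.
  by rewrite /x /y -surjective_pairing total_mobility_pt mulf_neq0 ?invr_eq0.
have sq (f : R -> R) (t df : R) c := @is_derive_sqr_div R f c t df.
have id t : is_derive t 1 (fun t : R => t) 1 by exact: is_derive_id.
have cst (c t : R) : is_derive t 1 (fun=> c) 0 by exact: is_derive_cst.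
have dTw : is_derive x 1 (fun t => total_mobility mw mo mg (t, y))
    (2 * x * 1 / mw + 2 * y * 0 / mo + 2 * (1 - x - y) * (0 - 1 - 0) / mg).
  exact: (is_deriveD (is_deriveD (sq _ _ _ _ (id x)) (sq _ _ _ _ (cst y x)))
    (sq _ _ _ _ (is_deriveB (is_deriveB (cst 1 x) (id x)) (cst y x)))).
have dTo : is_derive y 1 (fun t => total_mobility mw mo mg (x, t))
    (2 * x * 0 / mw + 2 * y * 1 / mo + 2 * (1 - x - y) * (0 - 0 - 1) / mg).
  exact: (is_deriveD (is_deriveD (sq _ _ _ _ (cst x y)) (sq _ _ _ _ (id y)))
    (sq _ _ _ _ (is_deriveB (is_deriveB (cst 1 y) (cst x y)) (id y)))).
pose Tw t := total_mobility mw mo mg (t, y).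
pose To t := total_mobility mw mo mg (x, t).
have [_ ww] := @is_derive_div _ _ Tw _ _ _ T0 (sq _ _ _ mw (id x)) dTw.
have [_ ow] := @is_derive_div _ _ Tw _ _ _ T0 (sq _ _ _ mo (cst y x)) dTw.
have [_ wo] := @is_derive_div _ _ To _ _ _ T0 (sq _ _ _ mw (cst x y)) dTo.
have [_ oo] := @is_derive_div _ _ To _ _ _ T0 (sq _ _ _ mo (id y)) dTo.
have TE : total_mobility mw mo mg (x, y) = den nu s / (mw + mo).
  by rewrite /x /y -surjective_pairing total_mobility_pt.
rewrite speed_a_sub_b // mxE /=.
case: (unliftP ord0 i) => [i' ->|->]; case: (unliftP ord0 j) => [j' ->|->];
  rewrite ?ord1 /= derive1E ?mul1r ?mul0r.
- rewrite [LHS]oo /To TE /x /y /speed_a /pt /nu_G /=.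
  by field; rewrite ?d0 ?mw_neq0 ?mo_neq0 ?mg_neq0 ?m_neq0.
- rewrite [LHS]ow /Tw TE /x /y /speed_a /pt /nu_G /=.
  by field; rewrite ?d0 ?mw_neq0 ?mo_neq0 ?mg_neq0 ?m_neq0.
- rewrite [LHS]wo /To TE /x /y /speed_a /pt /nu_G /=.
  by field; rewrite ?d0 ?mw_neq0 ?mo_neq0 ?mg_neq0 ?m_neq0.
- rewrite [LHS]ww /Tw TE /x /y /speed_a /pt /nu_G /=.
  by field; rewrite ?d0 ?mw_neq0 ?mo_neq0 ?mg_neq0 ?m_neq0.
Qed.

Lemma eigenvalues_pt s :
  [set z | eigenvalue (DF mw mo mg (pt s)) z] = [set speed_a nu s; speed_b nu s].
Proof.
have c1 : mw / (mw + mo) + mo / (mw + mo) = 1 by rewrite -mulrDl divff.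
apply/seteqP; split=> z /=; rewrite eigenvalue_2x2 !DF_pt /=.
  move=> h; have /eqP : (z - speed_a nu s) * (z - speed_b nu s) = 0.
    have {}c1 : mo / (mw + mo) = 1 - mw / (mw + mo) by rewrite -c1; lra.
    by move: h; rewrite c1; lra.
  by rewrite mulf_eq0 !subr_eq0 => /orP[] /eqP ->; [left|right].
have -> : mo / (mw + mo) = 1 - mw / (mw + mo) by rewrite -c1; lra.
by case=> ->; ring.
Qed.

Lemma lambda_s_pt s :
  lambda_s mw mo mg (pt s) = Num.min (speed_a nu s) (speed_b nu s).
Proof. by rewrite /lambda_s eigenvalues_pt inf_set2. Qed.

Lemma lambda_f_pt s :
  lambda_f mw mo mg (pt s) = Num.max (speed_a nu s) (speed_b nu s).
Proof. by rewrite /lambda_f eigenvalues_pt sup_set2. Qed.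

Lemma lambda_low s : s <= s_umb nu ->
  lambda_s mw mo mg (pt s) = speed_a nu s /\
  lambda_f mw mo mg (pt s) = speed_b nu s.
Proof.
by move=> /(speed_a_le_b nu_gt8) h;
  rewrite lambda_s_pt lambda_f_pt min_l // max_r.
Qed.

Lemma lambda_high s : s_umb nu <= s ->
  lambda_s mw mo mg (pt s) = speed_b nu s /\
  lambda_f mw mo mg (pt s) = speed_a nu s.
Proof.
by move=> /(speed_b_le_a nu_gt8) h;
  rewrite lambda_s_pt lambda_f_pt min_r // max_l.
Qed.

End ModelOnLine.

(** * Characteristic states and shocks *)

Section WavesOnLine.
Variables (R : realType) (mw mo mg : R).
Hypotheses (mw_gt0 : 0 < mw) (mo_gt0 : 0 < mo) (mg_gt0 : 0 < mg).
Hypothesis nu_gt8 : 8 < nu_G mw mo mg.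

Local Notation nu := (nu_G mw mo mg).
Local Notation pt := (pt mw mo).
Local Notation ext := (ext nu).
Local Notation ext_inv := (ext_inv nu).
Local Notation chord := (chord nu).
Local Notation speed_a := (speed_a nu).
Local Notation speed_b := (speed_b nu).
Local Notation s_umb := (s_umb nu).
Local Notation s_min := (s_min nu).
Implicit Types (s u m v : R).

Let m_gt0 : 0 < mw + mo. Proof. exact: addr_gt0. Qed.

(** Along the line the travelling wave system reduces to one scalar equation. *)
Lemma shock_pt u m : 0 <= u -> u < m -> m <= 1 -> 0 < concavity nu u u m ->
  shock mw mo mg (pt u) (pt m) (chord u m).
Proof.
move=> u0 um m1 tr0.
have inline s : 0 <= s <= 1 -> Omega (pt s) by move=> /(pt_line mw_gt0 mo_gt0)[].
split; try exact: rankine_hugoniot_chord.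
- by apply: inline; rewrite u0 ltW // (lt_le_trans um).
- by apply: inline; rewrite m1 ltW // (le_lt_trans u0).
have [x [xin dx xu xm]] := line_orbit nu_gt8 u0 m1 um tr0.
have lim F v : Filter F -> x t @[t --> F] --> v -> pt (x t) @[t --> F] --> pt v.
  move=> FF xv.
  exact: (cvg_pair (cvgM xv (cvg_cst (mw / (mw + mo))))
    (cvgM xv (cvg_cst (mo / (mw + mo))))).
exists (fun t => pt (x t)); split; [|exact: lim|exact: lim].
move=> t; split.
  by apply: inline; have /andP[? ?] := xin t; apply/andP; split; lra.
split; rewrite /pt /=.
- have -> : f_w mw mo mg (pt (x t)) - f_w mw mo mg (pt u) -
      chord u m * (x t * (mw / (mw + mo)) - u * (mw / (mw + mo))) =
      line_field nu u m (x t) * (mw / (mw + mo)).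
    by rewrite !f_w_pt // /line_field; ring.
  exact: is_derive_mulr.
- have -> : f_o mw mo mg (pt (x t)) - f_o mw mo mg (pt u) -
      chord u m * (x t * (mo / (mw + mo)) - u * (mo / (mw + mo))) =
      line_field nu u m (x t) * (mo / (mw + mo)).
    by rewrite !f_o_pt // /line_field; ring.
  exact: is_derive_mulr.
Qed.

Lemma seg_UDP M : seg_UD mw mo mg M <->
  exists2 m, s_umb < m <= 1 & M = pt m.
Proof.
split=> [[ML]|[m /andP[um m1] ->]].
  rewrite par_umb // => uM; exists (par M); last exact: line_pt.
  by rewrite uM; case/andP: (line_par ML).
split; last by rewrite par_pt // par_umb.
by apply: pt_line => //; rewrite m1 ltW // (lt_trans (s_umb_gt0 nu_gt8)).
Qed.

Lemma seg_GUP S : seg_GU_open mw mo mg S <->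
  exists2 u, 0 <= u < s_umb & S = pt u.
Proof.
split=> [[SL]|[u /andP[u0 uu] ->]].
  rewrite par_umb // => uS; exists (par S); last exact: line_pt.
  by rewrite uS andbT; case/andP: (line_par SL).
split; last by rewrite par_pt // par_umb.
by apply: pt_line => //; rewrite u0 ltW // (lt_trans uu) // s_umb_lt1.
Qed.

Section RightState.
Variable m : R.
Hypotheses (um : s_umb < m) (m1 : m <= 1).

Let m0 : 0 < m. Proof. exact: lt_trans (s_umb_gt0 nu_gt8) um. Qed.
Let ext_m : ext (ext_inv m) = m. Proof. by case: (ext_invK nu_gt8 m0 m1). Qed.
Let inv_ge : s_min <= ext_inv m. Proof. by case: (ext_invK nu_gt8 m0 m1). Qed.
Let inv_lt : ext_inv m < s_umb. Proof. exact: ext_inv_lt_umb. Qed.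
Let ext_ge : s_min <= ext m.
Proof.
have /andP[e1 _] := ext_range nu_gt8 um m1.
exact: le_trans (s_min_le_ext1 nu_gt8) e1.
Qed.
Let ext_lt : ext m < s_umb. Proof. by case/andP: (ext_range nu_gt8 um m1). Qed.

Let sigmaE u : u < s_umb -> sigma mw mo mg (pt u) (pt m) = chord u m.
Proof. by move=> uu; apply: sigma_pt => //; rewrite lt_eqF // (lt_trans uu). Qed.

Lemma sigma_eq_lambda_s u : u < s_umb ->
  (sigma mw mo mg (pt u) (pt m) = lambda_s mw mo mg (pt u)) <-> u = ext m.
Proof.
move=> uu; rewrite sigmaE //.
have [-> _] := lambda_low mw_gt0 mo_gt0 mg_gt0 nu_gt8 (ltW uu).
split=> [/eqP|->]; last exact: chord_ext.
by rewrite chord_eq_speed_a // => /eqP.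
Qed.

Lemma frakS_pt : frakS mw mo mg (pt m) = pt (ext m).
Proof.
apply: xget_unique => [|S] /=.
  split; last exact/sigma_eq_lambda_s.
  apply/seg_GUP; exists (ext m) => //.
  by rewrite ext_lt andbT (le_trans _ ext_ge) // ltW // s_min_gt0.
by move=> [/seg_GUP[u /andP[u0 uu] ->]] /(sigma_eq_lambda_s uu) ->.
Qed.

Lemma sigma_eq_lambda_f u : u < s_umb ->
  (sigma mw mo mg (pt u) (pt m) = lambda_f mw mo mg (pt m)) <-> ext u = m.
Proof.
move=> uu; rewrite sigmaE //.
have [_ ->] := lambda_high mw_gt0 mo_gt0 mg_gt0 nu_gt8 (ltW um).
rewrite chordC; split=> [/eqP|<-]; last exact: chord_ext.
by rewrite chord_eq_speed_a // => /eqP.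
Qed.

(** Among the states with the right speed, ext_inv m is the one with largest
    parameter, because beyond it ext takes values below m. *)
Lemma frakF_pt : frakF mw mo mg (pt m) = pt (ext_inv m).
Proof.
have inv0 : 0 <= ext_inv m < s_umb.
  by rewrite inv_lt andbT (le_trans _ inv_ge) // ltW // s_min_gt0.
have PF : seg_GU_open mw mo mg (pt (ext_inv m)).
  by apply/seg_GUP; exists (ext_inv m).
have LF : sigma mw mo mg (pt (ext_inv m)) (pt m) = lambda_f mw mo mg (pt m).
  exact/sigma_eq_lambda_f.
have max F : seg_GU_open mw mo mg F ->
    sigma mw mo mg F (pt m) = lambda_f mw mo mg (pt m) ->
    par F <= par (pt (ext_inv m)).
  move=> /seg_GUP[u /andP[u0 uu] ->] /(sigma_eq_lambda_f uu) eu.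
  rewrite !par_pt // leNgt; apply/negP => lt_u.
  have su := le_trans inv_ge (ltW lt_u).
  by have := ext_decr nu_gt8 inv_ge su lt_u; rewrite eu ext_m ltxx.
apply: xget_unique => [|F] /=; first by split.
move=> [/[dup] FS /seg_GUP[u /andP[u0 uu] FE] Fl Fmax].
have := max _ FS Fl; have := Fmax _ PF LF; rewrite FE !par_pt // => h1 h2.
by congr pt; apply/eqP; rewrite eq_le h1 h2.
Qed.

Lemma left_char_pt : left_char_s_shock mw mo mg (pt (ext m)) (pt m) (chord (ext m) m).
Proof.
have e0 := lt_le_trans (s_min_gt0 nu_gt8) ext_ge.
have tr : 0 < concavity nu (ext m) (ext m) m.
  apply: concavity_gt0 => //; first exact/ltW/(lt_trans ext_lt)/s_umb_lt1.
  exact/ltW/ext_ext_lt.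
have em := lt_trans ext_lt um.
have [ls lf] := lambda_high mw_gt0 mo_gt0 mg_gt0 nu_gt8 (ltW um).
split.
- by apply: shock_pt => //; exact: ltW.
- rewrite ls -chord_diag (chordC _ (ext m) m); apply: chord_lt => //.
  apply: (lt_le_trans tr); apply: (@le_trans _ _ (concavity nu m (ext m) (ext m))).
    by rewrite concavityC concavityCA.
  apply: concavity_incr; [exact: nu_gt8| | |exact: ltW].
    by rewrite m1 ltW.
  by rewrite !ltW // (lt_le_trans em).
- by have [-> _] := lambda_low mw_gt0 mo_gt0 mg_gt0 nu_gt8 (ltW ext_lt); rewrite chord_ext.
- rewrite lf chord_ext //.
  exact: lt_le_trans (speed_a_lt2 nu_gt8 ext_lt) (speed_a_ge2 nu_gt8 (ltW um) m1).
Qed.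

Lemma right_char_pt :
  right_char_f_shock mw mo mg (pt (ext_inv m)) (pt m) (chord (ext_inv m) m).
Proof.
have e0 := lt_le_trans (s_min_gt0 nu_gt8) inv_ge.
have tr : 0 < concavity nu (ext_inv m) (ext_inv m) m.
  apply: concavity_gt0 => //; first exact/ltW/(lt_trans inv_lt)/s_umb_lt1.
  by rewrite ext_m.
have em := lt_trans inv_lt um.
have c : chord (ext_inv m) m = speed_a m.
  exact: chord_ext_inv.
have [ls lf] := lambda_low mw_gt0 mo_gt0 mg_gt0 nu_gt8 (ltW inv_lt).
split.
- by apply: shock_pt => //; exact: ltW.
- by have [_ ->] := lambda_high mw_gt0 mo_gt0 mg_gt0 nu_gt8 (ltW um).
- by rewrite lf -chord_diag; exact: chord_lt.
- rewrite ls c.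
  exact: lt_le_trans (speed_a_lt2 nu_gt8 inv_lt) (speed_a_ge2 nu_gt8 (ltW um) m1).
Qed.

End RightState.

Lemma SCB_pairP S M : SCB_pair mw mo mg S M <->
  exists2 m, s_umb < m <= 1 & S = pt (ext m) /\ M = pt m.
Proof.
split=> [[/seg_GUP[u /andP[_ uu] ->] /seg_UDP[m um ->] [_ _ h _]]|].
  exists m => //; split=> //; congr pt.
  by case/andP: um => um m1; apply/(sigma_eq_lambda_s um uu).
move=> [m /andP[um m1] [-> ->]]; have /andP[e1 eu] := ext_range nu_gt8 um m1.
have e0 : 0 < ext m.
  exact: lt_le_trans (s_min_gt0 nu_gt8) (le_trans (s_min_le_ext1 nu_gt8) e1).
split.
- by apply/seg_GUP; exists (ext m) => //; rewrite eu ltW.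
- by apply/seg_UDP; exists m => //; rewrite um.
- rewrite sigma_pt ?lt_eqF ?(lt_trans eu) //; exact: left_char_pt.
Qed.

Lemma FCB_pairP F M : FCB_pair mw mo mg F M <->
  exists2 m, s_umb < m <= 1 & F = pt (ext_inv m) /\ M = pt m.
Proof.
split=> [[-> _ /seg_UDP[m /andP[um m1] ->] _]|].
  by exists m; rewrite ?um //; rewrite frakF_pt.
move=> [m /andP[um m1] [-> ->]].
have [_ si] := ext_invK nu_gt8 (lt_trans (s_umb_gt0 nu_gt8) um) m1.
have iu := ext_inv_lt_umb nu_gt8 um m1.
split.
- by rewrite frakF_pt.
- apply/seg_GUP; exists (ext_inv m) => //.
  by rewrite iu andbT (le_trans _ si) // ltW // s_min_gt0.
- by apply/seg_UDP; exists m => //; rewrite um.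
- rewrite sigma_pt ?lt_eqF ?(lt_trans iu) //; exact: right_char_pt.
Qed.

End WavesOnLine.

(** * The undercompressive surface and its boundary *)

Section UndercompressiveSurface.
Variables (R : realType) (mw mo mg : R).
Hypotheses (mw_gt0 : 0 < mw) (mo_gt0 : 0 < mo) (mg_gt0 : 0 < mg).
Hypothesis nu_gt8 : 8 < nu_G mw mo mg.

Local Notation nu := (nu_G mw mo mg).
Local Notation pt := (pt mw mo).
Local Notation ext := (ext nu).
Local Notation ext_inv := (ext_inv nu).
Local Notation chord := (chord nu).
Local Notation speed_a := (speed_a nu).
Local Notation s_umb := (s_umb nu).
Local Notation s_min := (s_min nu).
Implicit Types (s u m v : R).

Definition lift (f : R -> R) s : R * R * R := (pt s, f s).

Let w0 : 0 < s_umb. Proof. exact: s_umb_gt0. Qed.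
Let w1 : s_umb < 1. Proof. exact: s_umb_lt1. Qed.
Let inv1K : ext (ext_inv 1) = 1.
Proof. by have [] := ext_invK nu_gt8 ltr01 (lexx 1). Qed.
Let inv1_ge : s_min <= ext_inv 1.
Proof. by have [] := ext_invK nu_gt8 ltr01 (lexx 1). Qed.
Let ext1_ge : s_min <= ext 1. Proof. exact: s_min_le_ext1. Qed.
Let inv1_lt_ext1 : ext_inv 1 < ext 1. Proof. exact: ext_inv_lt_ext. Qed.
Let ext1_lt : ext 1 < s_umb. Proof. by case/andP: (ext_range nu_gt8 w1 (lexx 1)). Qed.
Let inv1_lt : ext_inv 1 < s_umb. Proof. exact: lt_trans ext1_lt. Qed.
Let min0 : 0 < s_min. Proof. exact: s_min_gt0. Qed.

Let inv_range m : s_umb < m -> m <= 1 -> ext_inv 1 <= ext_inv m < s_umb.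
Proof.
move=> um m1; have m0 := lt_trans w0 um.
have [e se] := ext_invK nu_gt8 m0 m1.
by rewrite ext_inv_lt_umb // andbT ext_invE // e.
Qed.

Let chord_inv m : s_umb < m -> m <= 1 -> chord (ext_inv m) m = speed_a m.
Proof. by move=> um m1; rewrite chord_ext_inv // (lt_trans w0 um). Qed.

Let sigma_low u m : u < s_umb -> s_umb < m ->
  sigma mw mo mg (pt u) (pt m) = chord u m.
Proof. by move=> uu um; apply: sigma_pt => //; rewrite lt_eqF // (lt_trans uu). Qed.

Lemma T_minusP p : T_minus mw mo mg p <-> exists m u,
  [/\ s_umb < m <= 1, ext_inv m <= u <= ext m & p = (pt u, chord u m)].
Proof.
split.
  move=> [M /(seg_UDP mw_gt0 mo_gt0 mg_gt0 nu_gt8)[m /andP[um m1] ->]].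
  move=> [U [UL]]; rewrite frakF_pt // frakS_pt // !par_pt // => /andP[Ui Ue] <-.
  exists m, (par U); rewrite um Ui Ue; split=> //.
  rewrite [in LHS](line_pt mw_gt0 mo_gt0 UL) sigma_low //.
  by apply: le_lt_trans Ue _; case/andP: (ext_range nu_gt8 um m1).
move=> [m [u [/andP[um m1] /andP[ui ue] ->]]].
have /andP[i1 _] := inv_range um m1; have /andP[_ eu] := ext_range nu_gt8 um m1.
have uu := le_lt_trans ue eu.
exists (pt m); first by apply/(seg_UDP mw_gt0 mo_gt0 mg_gt0 nu_gt8); exists m; rewrite ?um.
exists (pt u); last by rewrite sigma_low.
rewrite /mkset frakF_pt // frakS_pt // !par_pt // ui ue; split=> //; apply: pt_line => //.
rewrite (ltW (lt_trans uu w1)) andbT (le_trans _ ui) // (le_trans _ i1) //.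
exact: le_trans (ltW min0) inv1_ge.
Qed.

Lemma T_plusP p : T_plus mw mo mg p <-> exists m v,
  [/\ s_umb < m <= 1, speed_a (ext m) <= v <= speed_a m & p = (pt m, v)].
Proof.
split.
  move=> [M /(seg_UDP mw_gt0 mo_gt0 mg_gt0 nu_gt8)[m /andP[um m1] ->]].
  have /andP[_ iu] := inv_range um m1; have /andP[_ eu] := ext_range nu_gt8 um m1.
  rewrite /= frakF_pt // frakS_pt // !sigma_low // chord_ext // chord_inv //.
  by move=> [v + <-]; rewrite in_itv /= => vin; exists m, v; rewrite um.
move=> [m [v [/andP[um m1] vin ->]]].
have /andP[_ iu] := inv_range um m1; have /andP[_ eu] := ext_range nu_gt8 um m1.
exists (pt m); first by apply/(seg_UDP mw_gt0 mo_gt0 mg_gt0 nu_gt8); exists m; rewrite ?um.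
rewrite /= frakF_pt // frakS_pt // !sigma_low // chord_ext // chord_inv //.
by exists v => //; rewrite in_itv.
Qed.

Lemma SCB_minusP p : SCB_minus mw mo mg p <->
  exists2 m, s_umb < m <= 1 & p = lift speed_a (ext m).
Proof.
split=> [[S [M [/SCB_pairP]]]|[m mI ->]].
  move=> /(_ mw_gt0 mo_gt0 mg_gt0 nu_gt8)[m /andP[um m1] [-> ->]] ->; exists m.
    by rewrite um.
  have /andP[_ eu] := ext_range nu_gt8 um m1.
  by rewrite sigma_low // chord_ext.
have /andP[um m1] := mI; have /andP[_ eu] := ext_range nu_gt8 um m1.
exists (pt (ext m)), (pt m); split; first by apply/SCB_pairP => //; exists m.
by rewrite sigma_low // chord_ext.
Qed.

Lemma SCB_plusP p : SCB_plus mw mo mg p <->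
  exists2 m, s_umb < m <= 1 & p = lift (speed_a \o ext) m.
Proof.
split=> [[S [M [/SCB_pairP]]]|[m mI ->]].
  move=> /(_ mw_gt0 mo_gt0 mg_gt0 nu_gt8)[m /andP[um m1] [-> ->]] ->; exists m.
    by rewrite um.
  have /andP[_ eu] := ext_range nu_gt8 um m1.
  by rewrite sigma_low // chord_ext.
have /andP[um m1] := mI; have /andP[_ eu] := ext_range nu_gt8 um m1.
exists (pt (ext m)), (pt m); split; first by apply/SCB_pairP => //; exists m.
by rewrite sigma_low // chord_ext.
Qed.

Lemma FCB_minusP p : FCB_minus mw mo mg p <->
  exists2 m, s_umb < m <= 1 & p = (pt (ext_inv m), speed_a m).
Proof.
split=> [[S [M [/FCB_pairP]]]|[m mI ->]].
  move=> /(_ mw_gt0 mo_gt0 mg_gt0 nu_gt8)[m /andP[um m1] [-> ->]] ->; exists m.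
    by rewrite um.
  have /andP[_ iu] := inv_range um m1.
  by rewrite sigma_low // chord_inv.
have /andP[um m1] := mI; have /andP[_ iu] := inv_range um m1.
exists (pt (ext_inv m)), (pt m); split; first by apply/FCB_pairP => //; exists m.
by rewrite sigma_low // chord_inv.
Qed.

Lemma FCB_plusP p : FCB_plus mw mo mg p <->
  exists2 m, s_umb < m <= 1 & p = lift speed_a m.
Proof.
split=> [[S [M [/FCB_pairP]]]|[m mI ->]].
  move=> /(_ mw_gt0 mo_gt0 mg_gt0 nu_gt8)[m /andP[um m1] [-> ->]] ->; exists m.
    by rewrite um.
  have /andP[_ iu] := inv_range um m1.
  by rewrite sigma_low // chord_inv.
have /andP[um m1] := mI; have /andP[_ iu] := inv_range um m1.
exists (pt (ext_inv m)), (pt m); split; first by apply/FCB_pairP => //; exists m.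
by rewrite sigma_low // chord_inv.
Qed.

Lemma GUB_rangeP U : GUB_range mw mo mg U <->
  exists2 u, ext_inv 1 < u < ext 1 & U = pt u.
Proof.
rewrite /GUB_range /mkset -(pt1 mw mo) frakF_pt // frakS_pt // !par_pt //.
split=> [[UL UI]|[u uI ->]]; first by exists (par U) => //; exact: line_pt.
rewrite par_pt //; split=> //; apply: pt_line => //.
have /andP[ui ue] := uI; apply/andP; split.
  exact: le_trans (ltW min0) (le_trans inv1_ge (ltW ui)).
exact: ltW (lt_trans ue (lt_trans ext1_lt w1)).
Qed.

Lemma GUB_minusE :
  GUB_minus mw mo mg = lift (fun u => chord u 1) @` `]ext_inv 1, ext 1[.
Proof.
apply/seteqP; split=> p [U]; rewrite /= ?in_itv /=.
  move=> /GUB_rangeP[u /[dup] uI /andP[_ ue] ->] <-; exists u; rewrite /= ?in_itv //.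
  by rewrite /lift -(pt1 mw mo) // sigma_low // (lt_trans ue).
move=> /[dup] uI /andP[_ ue] <-; exists (pt U); first by apply/GUB_rangeP; exists U.
by rewrite /lift -(pt1 mw mo) // sigma_low // (lt_trans ue).
Qed.

Lemma GUB_plusE :
  GUB_plus mw mo mg = (fun u => (pt 1, chord u 1)) @` `]ext_inv 1, ext 1[.
Proof.
apply/seteqP; split=> p [U]; rewrite /= ?in_itv /=.
  move=> /GUB_rangeP[u /[dup] uI /andP[_ ue] ->] <-; exists u; rewrite /= ?in_itv //.
  by rewrite -(pt1 mw mo) // sigma_low // (lt_trans ue).
move=> /[dup] uI /andP[_ ue] <-; exists (pt U); first by apply/GUB_rangeP; exists U.
by rewrite -(pt1 mw mo) // sigma_low // (lt_trans ue).
Qed.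

Lemma continuous_pt : continuous pt.
Proof. by apply: continuous_pair; poly_continuous. Qed.

Lemma continuous_lift (f : R -> R) : continuous f -> continuous (lift f).
Proof. by move=> cf; apply: continuous_pair => //; exact: continuous_pt. Qed.

Lemma pt_inj : injective pt.
Proof. by move=> s t e; rewrite -(par_pt mw_gt0 mo_gt0 s) e par_pt. Qed.

Lemma coords_lift (f : R -> R) (a b : R) :
  coords @` (lift f @` `[a, b]) = graph f a b.
Proof.
rewrite image_comp; congr (_ @` _); apply/funext => s.
by rewrite /coords /= par_pt.
Qed.

Let hausdorff : hausdorff_space (R * R * R)%type.
Proof. exact: norm_hausdorff. Qed.

Lemma closure_lift (f : R -> R) (a b : R) (C : set (R * R * R)) : a < b ->
  continuous f -> lift f @` `]a, b[ `<=` C -> C `<=` lift f @` `[a, b] ->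
  closure C = lift f @` `[a, b].
Proof. by move=> ab cf; apply: closure_arc => //; exact: continuous_lift. Qed.

Lemma lift_arc (f : R -> R) (a b : R) : a < b -> continuous f ->
  simple_arc R (lift f @` `[a, b]) (lift f a) (lift f b).
Proof.
move=> ab cf; apply: simple_arc_image => //.
  by apply: continuous_subspaceT; exact: continuous_lift.
by move=> s t _ _ [] w' o _; apply: pt_inj; rewrite /pt w' o.
Qed.

Let csa : continuous speed_a. Proof. exact: continuous_speed_a. Qed.
Let csae : continuous (speed_a \o ext).
Proof. exact: continuous_speed_a_ext. Qed.
Let cch : continuous (fun u => chord u 1).
Proof. exact: continuous_chord_l. Qed.

Lemma closure_SCB_minus :
  closure (SCB_minus mw mo mg) = lift speed_a @` `[ext 1, s_umb].
Proof.
apply: closure_lift => // p.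
  move=> [u /=]; rewrite in_itv /= => /andP[eu uu] <-; apply/SCB_minusP.
  have u0 : 0 < u by rewrite (lt_trans min0) // (le_lt_trans ext1_ge).
  have u1 := ltW (lt_trans uu w1).
  have [e se] := ext_invK nu_gt8 u0 u1.
  exists (ext_inv u); last by rewrite e.
  rewrite -(ext_ltP nu_gt8 (ltW (s_min_umb nu_gt8)) se) ext_umb // e uu.
  rewrite (ext_invE nu_gt8 u0 u1) ?(ltW eu) //.
  exact: ltW (lt_trans (s_min_umb nu_gt8) w1).
move=> /SCB_minusP[m /andP[um m1] ->]; have /andP[me mu] := ext_range nu_gt8 um m1.
by exists (ext m); rewrite //= in_itv /= me ltW.
Qed.

Lemma closure_SCB_plus :
  closure (SCB_plus mw mo mg) = lift (speed_a \o ext) @` `[s_umb, 1].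
Proof.
apply: closure_lift => // p.
  move=> [m /=]; rewrite in_itv /= => /andP[um m1] <-; apply/SCB_plusP.
  by exists m; rewrite ?um ?ltW.
move=> /SCB_plusP[m /andP[um m1] ->].
by exists m; rewrite //= in_itv /= m1 ltW.
Qed.

Lemma closure_FCB_minus :
  closure (FCB_minus mw mo mg) = lift (speed_a \o ext) @` `[ext_inv 1, s_umb].
Proof.
apply: closure_lift => // p.
  move=> [u /=]; rewrite in_itv /= => /andP[iu uu] <-; apply/FCB_minusP.
  have su := le_trans inv1_ge (ltW iu).
  have we := ext_gt_umb nu_gt8 su uu.
  have e1 : ext u <= 1 by rewrite -ext_invE // ltW.
  by exists (ext u); rewrite ?we // extK // (lt_trans w0).
move=> /FCB_minusP[m /andP[um m1] ->]; have /andP[mi mu] := inv_range um m1.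
have [e _] := ext_invK nu_gt8 (lt_trans w0 um) m1.
by exists (ext_inv m); rewrite /= ?in_itv /= ?mi ?ltW // /lift /= e.
Qed.

Lemma closure_FCB_plus :
  closure (FCB_plus mw mo mg) = lift speed_a @` `[s_umb, 1].
Proof.
apply: closure_lift => // p.
  move=> [m /=]; rewrite in_itv /= => /andP[um m1] <-; apply/FCB_plusP.
  by exists m; rewrite ?um ?ltW.
move=> /FCB_plusP[m /andP[um m1] ->].
by exists m; rewrite //= in_itv /= m1 ltW.
Qed.

Let oo_sub_cc (f : R -> R * R * R) (a b : R) : f @` `]a, b[ `<=` f @` `[a, b].
Proof. by apply: image_subset => x /=; apply: subset_itv_oo_cc. Qed.

Lemma closure_GUB_minus : closure (GUB_minus mw mo mg) =
  lift (fun u => chord u 1) @` `[ext_inv 1, ext 1].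
Proof. by rewrite GUB_minusE; apply: closure_lift. Qed.

Let chord_inv1 : chord (ext_inv 1) 1 = 2.
Proof. by rewrite chord_inv // speed_a1. Qed.
Let chord_ext1 : chord (ext 1) 1 = speed_a (ext 1).
Proof. exact: chord_ext. Qed.
Let speed_ext_lt2 m : s_umb < m -> m <= 1 -> speed_a (ext m) < 2.
Proof.
by move=> um m1; apply: speed_a_lt2 => //; case/andP: (ext_range nu_gt8 um m1).
Qed.

Let chord1_range u : ext_inv 1 <= u <= ext 1 ->
  speed_a (ext 1) <= chord u 1 <= 2.
Proof.
rewrite -chord_ext1 -chord_inv1 => /andP[iu ue]; apply/andP; split.
  move: ue; rewrite le_eqVlt => /orP[/eqP -> //|ue]; apply/ltW/chord_decr_l => //.
    exact: le_trans iu.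
  by rewrite -ext_invE // (le_trans inv1_ge).
move: iu; rewrite le_eqVlt => /orP[/eqP -> //|iu]; apply/ltW/chord_decr_l => //.
  exact: le_lt_trans ext1_lt.
by rewrite inv1K.
Qed.

Lemma closure_GUB_plus : closure (GUB_plus mw mo mg) =
  (fun v => (pt 1, v)) @` `[speed_a (ext 1), 2].
Proof.
rewrite GUB_plusE; apply: closure_arc => //; first exact: speed_ext_lt2.
- have c1 : continuous (fun _ : R => pt 1) by move=> ?; exact: cvg_cst.
  by apply: (continuous_pair c1); poly_continuous.
- move=> _ [v /= + <-]; rewrite in_itv /= => /andP[v1 v2].
  have [|u] := IVT (ltW inv1_lt_ext1) (continuous_subspaceT cch) (v := v).
    by rewrite chord_inv1 chord_ext1 ge_min le_max (ltW v1) (ltW v2) orbT.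
  rewrite in_itv /= => /andP[iu ue] uv; exists u; last by rewrite uv.
  rewrite /= in_itv /= !lt_neqAle iu ue !andbT; apply/andP; split; apply/eqP => e.
    by move: v2; rewrite -uv -e chord_inv1 ltxx.
  by move: v1; rewrite -uv e chord_ext1 ltxx.
- move=> _ [u /= + <-]; rewrite in_itv /= => /andP[iu ue].
  by exists (chord u 1) => //=; rewrite in_itv /= chord1_range // !ltW.
Qed.

Lemma T_minus_plane : T_minus mw mo mg `<=` plane_GD mw mo.
Proof.
move=> p /T_minusP[m [u [/andP[um m1] /andP[iu ue] ->]]].
have /andP[i1 _] := inv_range um m1; have /andP[_ eu] := ext_range nu_gt8 um m1.
have u0 : 0 <= u := le_trans (ltW min0) (le_trans inv1_ge (le_trans i1 iu)).
have u1 := lt_trans (le_lt_trans ue eu) w1.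
split=> /=; first by apply: pt_line => //; rewrite u0 ltW.
by apply: chord_gt0 => //; exact: lt_trans um.
Qed.

Lemma T_plus_plane : T_plus mw mo mg `<=` plane_GD mw mo.
Proof.
move=> p /T_plusP[m [v [/andP[um m1] /andP[ev _] ->]]].
have m0 := lt_trans w0 um.
split=> /=; first by apply: pt_line => //; rewrite m1 ltW.
apply: lt_le_trans ev; have /andP[e1 _] := ext_range nu_gt8 um m1.
rewrite /speed_a divr_gt0 ?den_gt0 // mulr_gt0 //.
exact: lt_le_trans min0 (le_trans ext1_ge e1).
Qed.

Lemma SCB_minus_sub : SCB_minus mw mo mg `<=` T_minus mw mo mg.
Proof.
move=> p /SCB_minusP[m /[dup] mI /andP[um m1] ->]; apply/T_minusP.
exists m, (ext m); split=> //; last by rewrite chord_ext.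
by rewrite lexx andbT ltW // ext_inv_lt_ext.
Qed.

Lemma FCB_minus_sub : FCB_minus mw mo mg `<=` T_minus mw mo mg.
Proof.
move=> p /FCB_minusP[m /[dup] mI /andP[um m1] ->]; apply/T_minusP.
exists m, (ext_inv m); split=> //; last by rewrite chord_inv.
by rewrite lexx ltW // ext_inv_lt_ext.
Qed.

Lemma GUB_minus_sub : GUB_minus mw mo mg `<=` T_minus mw mo mg.
Proof.
rewrite GUB_minusE => _ [u /= + <-]; rewrite in_itv /= => /andP[iu ue].
by apply/T_minusP; exists 1, u; rewrite w1 lexx !ltW.
Qed.

Lemma SCB_plus_sub : SCB_plus mw mo mg `<=` T_plus mw mo mg.
Proof.
move=> p /SCB_plusP[m /[dup] mI /andP[um m1] ->]; apply/T_plusP.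
exists m, (speed_a (ext m)); rewrite lexx; split=> //=.
exact: ltW (lt_le_trans (speed_ext_lt2 um m1) (speed_a_ge2 nu_gt8 (ltW um) m1)).
Qed.

Lemma FCB_plus_sub : FCB_plus mw mo mg `<=` T_plus mw mo mg.
Proof.
move=> p /FCB_plusP[m /[dup] mI /andP[um m1] ->]; apply/T_plusP.
exists m, (speed_a m); rewrite lexx andbT; split=> //=.
exact: ltW (lt_le_trans (speed_ext_lt2 um m1) (speed_a_ge2 nu_gt8 (ltW um) m1)).
Qed.

Lemma GUB_plus_sub : GUB_plus mw mo mg `<=` T_plus mw mo mg.
Proof.
rewrite GUB_plusE => _ [u /= + <-]; rewrite in_itv /= => /andP[iu ue].
apply/T_plusP; exists 1, (chord u 1); rewrite w1 lexx; split=> //.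
by rewrite speed_a1 // chord1_range // !ltW.
Qed.

(** The speeds that a right state m admits form the interval from
    speed_a (ext m) to speed_a m; it shrinks to the point 2 at m = s_umb. *)
Lemma region_plus : region_bounded_by
  (coords @` (closure (SCB_plus mw mo mg) `|` closure (FCB_plus mw mo mg)
     `|` closure (GUB_plus mw mo mg)))
  (coords @` (T_plus mw mo mg `|` [set (umbilic mw mo mg, 2)])).
Proof.
have -> : coords @` (closure (SCB_plus mw mo mg) `|` closure (FCB_plus mw mo mg)
     `|` closure (GUB_plus mw mo mg)) =
    graph (speed_a \o ext) s_umb 1 `|` graph speed_a s_umb 1
      `|` vertical_side 1 ((speed_a \o ext) 1) (speed_a 1).
  rewrite closure_SCB_plus closure_FCB_plus closure_GUB_plus !image_setU.
  rewrite !coords_lift; congr (_ `|` _); rewrite image_comp /= speed_a1 //.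
  by congr (_ @` _); apply/funext => v; rewrite /coords /= par_pt.
have -> : coords @` (T_plus mw mo mg `|` [set (umbilic mw mo mg, 2)]) =
    between s_umb 1 (speed_a \o ext) speed_a.
  apply/seteqP; split=> [_ [p [Tp|->] <-]|[m v] [/= /andP[um m1] vin]].
  - have /T_plusP[m [v [/andP[um m1] vin ->]]] := Tp; rewrite /between /coords /= par_pt //.
    by rewrite vin m1 ltW.
  - rewrite /between /coords /= par_umb // lexx (ltW w1) ext_umb // speed_a_umb //.
    by rewrite lexx.
  move: um; rewrite le_eqVlt => /orP[/eqP um|um].
    exists (umbilic mw mo mg, 2); first by right.
    rewrite /coords /= par_umb // um; congr (_, _).
    by move: vin; rewrite -um ext_umb // speed_a_umb // -eq_le => /eqP.
  exists (pt m, v); last by rewrite /coords /= par_pt.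
  by left; apply/T_plusP; exists m, v; rewrite um.
apply: region_between => //=.
- by rewrite ext_umb.
- move=> m /andP[um m1].
  exact: lt_le_trans (speed_ext_lt2 um (ltW m1)) (speed_a_ge2 nu_gt8 (ltW um) (ltW m1)).
- by rewrite speed_a1 // ltW // speed_ext_lt2.
Qed.

(* For a left state u the right state ranges over the m in [ext u, 1] with
   u <= ext m. The lowest speed is attained at m = 1 if u <= ext 1, and else at
   the m with ext m = u, where the speed is speed_a u. *)
Let lower u := Num.max (chord u 1) (speed_a u).

Let lower_left u : u <= ext 1 -> lower u = chord u 1.
Proof. by move=> ue; rewrite /lower max_l // speed_a_le_chord. Qed.

Let lower_right u : ext 1 <= u -> lower u = speed_a u.
Proof. by move=> ue; rewrite /lower max_r // chord_le_speed_a. Qed.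

Let lower_graph : graph lower (ext_inv 1) s_umb =
  graph speed_a (ext 1) s_umb `|` graph (fun u => chord u 1) (ext_inv 1) (ext 1).
Proof.
apply/seteqP; split=> p.
  move=> [u /= + <-]; rewrite in_itv /= => /andP[iu uu].
  have [eu|ue] := leP (ext 1) u.
    by left; exists u; rewrite /= ?in_itv /= ?eu ?lower_right.
  by right; exists u; rewrite /= ?in_itv /= ?iu ?lower_left ?ltW.
move=> [] [u /= + <-]; rewrite in_itv /= => /andP[h1 h2]; exists u.
- by rewrite /= in_itv /= h2 (le_trans (ltW inv1_lt_ext1)).
- by rewrite lower_right.
- by rewrite /= in_itv /= h1 (le_trans h2) // ltW.
- by rewrite lower_left.
Qed.

Let chord_extr u : chord u (ext u) = speed_a (ext u).
Proof. by rewrite chordC chord_ext. Qed.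

(** For a fixed left state u the speed chord u m decreases continuously as the
    right state m increases from ext u, where it equals speed_a (ext u); so the
    speeds realised at u fill the segment down to lower u. *)
Lemma region_minus : region_bounded_by
  (coords @` (closure (SCB_minus mw mo mg) `|` closure (FCB_minus mw mo mg)
     `|` closure (GUB_minus mw mo mg)))
  (coords @` (T_minus mw mo mg `|` [set (umbilic mw mo mg, 2)])).
Proof.
have lower_umb : lower s_umb = 2.
  by rewrite lower_right ?speed_a_umb // ltW.
have upper_umb : speed_a (ext s_umb) = 2 by rewrite ext_umb ?speed_a_umb.
have lower_inv1 : lower (ext_inv 1) = 2 by rewrite lower_left // ltW.
have -> : coords @` (closure (SCB_minus mw mo mg) `|` closure (FCB_minus mw mo mg)
     `|` closure (GUB_minus mw mo mg)) =
    graph lower (ext_inv 1) s_umb `|` graph (speed_a \o ext) (ext_inv 1) s_umb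
      `|` vertical_side s_umb (lower s_umb) ((speed_a \o ext) s_umb).
  rewrite closure_SCB_minus closure_FCB_minus closure_GUB_minus !image_setU.
  rewrite !coords_lift setUAC -lower_graph; apply/esym/setUidPl => _ [v /= + <-].
  rewrite in_itv /= lower_umb upper_umb -eq_le => /eqP <-.
  by right; exists s_umb; rewrite /= ?upper_umb // in_itv /= lexx ltW.
have -> : coords @` (T_minus mw mo mg `|` [set (umbilic mw mo mg, 2)]) =
    between (ext_inv 1) s_umb lower (speed_a \o ext).
  apply/seteqP; split=> [_ [p [Tp|->] <-]|[u v] [/= /andP[iu uu] vin]].
  - have /T_minusP[m [u [/andP[um m1] /andP[iu ue] ->]]] := Tp.
    have m0 := lt_trans w0 um.
    have /andP[i1 _] := inv_range um m1; have /andP[_ eu] := ext_range nu_gt8 um m1.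
    have i1u := le_trans i1 iu; have uu := le_lt_trans ue eu.
    have su := le_trans inv1_ge i1u.
    have eum : ext u <= m by rewrite -ext_invE.
    rewrite /between /coords /= par_pt // i1u (ltW uu); split=> //.
    rewrite /lower ge_max speed_a_le_chord // ue andbT -chord_extr.
    apply/andP; split.
      move: m1; rewrite le_eqVlt => /orP[/eqP -> //|m1].
      exact/ltW/chord_decr_r.
    move: eum; rewrite le_eqVlt => /orP[/eqP -> //|eum].
    exact/ltW/chord_decr_r.
  - rewrite /between /coords /= par_umb // lexx (ltW inv1_lt) upper_umb lower_umb.
    by rewrite lexx.
  move: uu; rewrite le_eqVlt => /orP[/eqP uu|uu].
    exists (umbilic mw mo mg, 2); first by right.
    rewrite /coords /= par_umb // uu; congr (_, _).
    by move: vin; rewrite uu upper_umb lower_umb -eq_le => /eqP.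
  have su := le_trans inv1_ge iu; have we := ext_gt_umb nu_gt8 su uu.
  have e1 : ext u <= 1 by rewrite -ext_invE.
  move: vin; rewrite /lower ge_max => /andP[/andP[cv sv] vc].
  have [|m] := IVT e1 (continuous_subspaceT (@continuous_chord _ _ nu_gt8 u)) (v := v).
    by rewrite chord_extr ge_min le_max cv vc orbT.
  rewrite in_itv /= => /andP[em m1] cm; exists (pt u, v); last by rewrite /coords /= par_pt.
  left; apply/T_minusP; exists m, u; rewrite -cm; split=> //.
    by rewrite m1 (lt_le_trans we).
  rewrite ext_invE // ?em /=; last exact: lt_le_trans (lt_trans w0 we) em.
  by rewrite -speed_a_le_chord // cm.
apply: region_between => //=.
- exact: (max_fun_continuous cch csa).
- by rewrite lower_inv1 inv1K speed_a1.
- move=> u /andP[iu uu]; have su := le_trans inv1_ge (ltW iu).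
  have we := ext_gt_umb nu_gt8 su uu.
  have e1 : ext u < 1 by rewrite -inv1K ext_ltP.
  rewrite /lower gt_max -chord_extr chord_decr_r //= chord_extr.
  exact: lt_le_trans (speed_a_lt2 nu_gt8 uu) (speed_a_ge2 nu_gt8 (ltW we) (ltW e1)).
- by rewrite upper_umb lower_umb.
Qed.

End UndercompressiveSurface.

Theorem lemma6p2 (R : realType) (mw mo mg : R)
  (mw_gt0 : 0 < mw) (mo_gt0 : 0 < mo) (mg_gt0 : 0 < mg)
  (nu_gt8 : 8 < nu_G mw mo mg) (D1 D2s : R * R)
  (D1_line : line_GD mw mo D1)
  (D1_char : lambda_s mw mo mg D1 = sigma mw mo mg D1 (vD mw mo))
  (D1_par : par D1 = nu_G mw mo mg / (2 + nu_G mw mo mg))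
  (D2s_line : line_GD mw mo D2s)
  (D2s_le : par D2s <= par (umbilic mw mo mg))
  (D2s_ext : sigma mw mo mg D2s (vD mw mo) = lambda_f mw mo mg (vD mw mo))
  (D2s_par : par D2s =
     (3 * nu_G mw mo mg + Num.sqrt (nu_G mw mo mg * (nu_G mw mo mg - 8)))
       / (4 * (nu_G mw mo mg + 1))) :
  let T_m := T_minus mw mo mg in
  let T_p := T_plus mw mo mg in
  let SCB_m := SCB_minus mw mo mg in
  let SCB_p := SCB_plus mw mo mg in
  let FCB_m := FCB_minus mw mo mg in
  let FCB_p := FCB_plus mw mo mg in
  let GUB_m := GUB_minus mw mo mg in
  let GUB_p := GUB_plus mw mo mg in
  let U_hat : R * R * R := (umbilic mw mo mg, 2) in
  let D1_hat := (D1, sigma mw mo mg D1 (vD mw mo)) in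
  let D_hat := (vD mw mo, sigma mw mo mg D1 (vD mw mo)) in
  let D2s_hat := (D2s, sigma mw mo mg D2s (vD mw mo)) in
  let D_check := (vD mw mo, sigma mw mo mg D2s (vD mw mo)) in
  (T_m `<=` plane_GD mw mo /\ T_p `<=` plane_GD mw mo) /\
  (region_bounded_by
     (coords @` (closure SCB_m `|` closure FCB_m `|` closure GUB_m))
     (coords @` (T_m `|` [set U_hat])) /\
   region_bounded_by
     (coords @` (closure SCB_p `|` closure FCB_p `|` closure GUB_p))
     (coords @` (T_p `|` [set U_hat]))) /\
  [/\ SCB_m `<=` T_m, SCB_p `<=` T_p,
      simple_arc R (closure SCB_m) D1_hat U_hat & simple_arc R (closure SCB_p) U_hat D_hat] /\
  [/\ FCB_m `<=` T_m, FCB_p `<=` T_p,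
      simple_arc R (closure FCB_m) D2s_hat U_hat & simple_arc R (closure FCB_p) D_check U_hat] /\
  [/\ GUB_m `<=` T_m, GUB_p `<=` T_p,
      simple_arc R (closure GUB_m) D2s_hat D1_hat & simple_arc R (closure GUB_p) D_check D_hat].
Proof.
have D1E : D1 = pt mw mo (ext (nu_G mw mo mg) 1).
  by rewrite ext1 -D1_par; exact: line_pt.
have D2E : D2s = pt mw mo (ext_inv (nu_G mw mo mg) 1).
  by rewrite ext_inv1 -D2s_par; exact: line_pt.
have w1 := s_umb_lt1 nu_gt8.
have /andP[_ ew] := ext_range nu_gt8 w1 (lexx 1).
have ie := ext_inv_lt_ext nu_gt8 w1 (lexx 1).
have [e1 _] := ext_invK nu_gt8 ltr01 (lexx 1).
set nu := nu_G mw mo mg in D1E D2E w1 ew ie e1 *.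
have s1 : sigma mw mo mg D1 (vD mw mo) = speed_a nu (ext nu 1).
  by rewrite D1E -(pt1 mw mo) sigma_pt ?chord_ext // lt_eqF // (lt_trans ew).
have s2 : sigma mw mo mg D2s (vD mw mo) = 2.
  rewrite D2E -(pt1 mw mo) sigma_pt // ?lt_eqF ?(lt_trans ie) ?(lt_trans ew) //.
  by rewrite chord_ext_inv // speed_a1.
have ca := continuous_speed_a nu_gt8.
have cae := continuous_speed_a_ext nu_gt8.
have cc := @continuous_chord_l _ _ nu_gt8 1.
have c1 : chord nu (ext_inv nu 1) 1 = 2 by rewrite chord_ext_inv // speed_a1.
rewrite /= s1 s2 D1E D2E -(pt1 mw mo).
split; first by split; [exact: T_minus_plane|exact: T_plus_plane].
split; first by split; [exact: region_minus|exact: region_plus].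
split; [split|split; split].
- exact: SCB_minus_sub.
- exact: SCB_plus_sub.
- rewrite closure_SCB_minus //.
  have := @lift_arc R mw mo mw_gt0 mo_gt0 (speed_a nu) _ _ ew ca.
  by rewrite /lift speed_a_umb // pt_umb.
- rewrite closure_SCB_plus //.
  have := @lift_arc R mw mo mw_gt0 mo_gt0 _ _ _ w1 cae.
  by rewrite /lift /= ext_umb // speed_a_umb // pt_umb.
- exact: FCB_minus_sub.
- exact: FCB_plus_sub.
- rewrite closure_FCB_minus //.
  have := @lift_arc R mw mo mw_gt0 mo_gt0 _ _ _ (lt_trans ie ew) cae.
  by rewrite /lift /= e1 speed_a1 // ext_umb // speed_a_umb // pt_umb.
- rewrite closure_FCB_plus //; apply: simple_arc_sym.
  have := @lift_arc R mw mo mw_gt0 mo_gt0 _ _ _ w1 ca.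
  by rewrite /lift speed_a1 // speed_a_umb // pt_umb.
- exact: GUB_minus_sub.
- exact: GUB_plus_sub.
- rewrite closure_GUB_minus //.
  have := @lift_arc R mw mo mw_gt0 mo_gt0 _ _ _ ie cc.
  by rewrite /lift c1 chord_ext.
- rewrite closure_GUB_plus //; apply: simple_arc_sym.
  apply: (@simple_arc_image R _ (fun v => (pt mw mo 1, v))).
  + exact: speed_a_lt2.
  + apply: continuous_subspaceT.
    have c0 : continuous (fun _ : R => pt mw mo 1) by move=> ?; exact: cvg_cst.
    by apply: (continuous_pair c0); poly_continuous.
  + by move=> u v _ _ [].
Qed.
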